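(* There exists an algorithm with input a finitely generated free group $F$, an endomorphism $\phi:F\to F$ and two elements $u,v\in F$, and output either a pair $(p,q)\in\mathbb{N}_0\times\mathbb{N}_0$ such that $\phi^p(u)=\phi^q(v)$, or $\mathrm{no}$ if no such pair exists.
   Context: $\mathbb{N}_0=\{0,1,2,\ldots\}$ and $\phi^0$ is the identity map. The free group is given by a finite free basis, elements are given as words over the basis and its inverses, and $\phi$ is given by the images of the basis elements. *)

(* Defs.v *)
From HB Require Import structures.
From mathcomp Require Import all_boot.

Set Implicit Arguments.
Unset Strict Implicit.
Unset Printing Implicit Defensive.

(* Finitely generated free groups: x is a free basis of F if it has the       *)
(* universal property of free groups. Multiplicative maps between groups are  *)
(* exactly the group homomorphisms (they preserve 1 and inverses).            *)
Definition free_basis (n : nat) (F : groupType) (x : 'I_n -> F) : Prop :=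
  forall (G : groupType) (f : 'I_n -> G),
    exists h : {multiplicative F -> G},
      (forall i, h (x i) = f i) /\
      (forall k : {multiplicative F -> G},
         (forall i, k (x i) = f i) -> forall a, k a = h a).

(* Words, not necessarily reduced: (i, false) is the i-th basis letter and    *)
(* (i, true) is its formal inverse.                                           *)
Definition word (n : nat) := seq ('I_n * bool).

Definition eval_word (n : nat) (F : groupType) (x : 'I_n -> F) (w : word n) : F :=
  (\prod_(l <- w) (if l.2 then (x l.1)^-1 else x l.1))%g.

(* Algorithms are mu-recursive functions: murec n is the syntax of programs   *)
(* for n-ary partial recursive functions, and computes f x z means that       *)
(* program f halts on input x with output z. It is deterministic, and has no  *)
(* output exactly when f diverges on x.                                       *)
Inductive murec : nat -> Type :=
| MuZero n : murec n
| MuSucc : murec 1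
| MuProj n (i : 'I_n) : murec n
| MuComp m n (f : murec m) (g : 'I_m -> murec n) : murec n
| MuRec n (f : murec n) (g : murec n.+2) : murec n.+1
| MuMin n (f : murec n.+1) : murec n.

Fixpoint computes n (f : murec n) : n.-tuple nat -> nat -> Prop :=
  match f in murec n return n.-tuple nat -> nat -> Prop with
  | MuZero _ => fun _ z => z = 0
  | MuSucc => fun x z => z = (thead x).+1
  | MuProj _ i => fun x z => z = tnth x i
  | MuComp m _ f g => fun x z =>
      exists2 y : m.-tuple nat,
        forall i, computes (g i) x (tnth y i) & computes f y z
  (* r 0, ..., r (thead x) are the successive values of the recursion, which  *)
  (* runs on the first argument.                                              *)
  | MuRec _ f g => fun x z =>
      exists r : nat -> nat,
        [/\ computes f (behead_tuple x) (r 0),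
            forall k, k < thead x ->
              computes g [tuple of k :: r k :: behead_tuple x] (r k.+1)
          & z = r (thead x)]
  (* The values at all j < k must be defined and nonzero.                     *)
  | MuMin _ f => fun x k =>
      computes f [tuple of k :: x] 0 /\
      forall j, j < k -> exists y, computes f [tuple of j :: x] y.+1
  end.

(* Input and output encodings, built on CodeSeq.code, the effective bijection *)
(* from seq nat to nat. The letter (i, b) is encoded by 2 * i + b.            *)
Definition code_word (n : nat) (w : word n) : nat :=
  CodeSeq.code [seq (nat_of_ord l.1).*2 + nat_of_bool l.2 | l <- w].

Definition code_words (n : nat) (ws : seq (word n)) : nat :=
  CodeSeq.code [seq code_word w | w <- ws].

(* None stands for the answer "no". *)
Definition code_answer (a : option (nat * nat)) : nat :=
  if a is Some (p, q) then (CodeSeq.code [:: p; q]).+1 else 0.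

(* The input data: the rank n, the images w of the basis elements under the   *)
(* endomorphism, and the two words u and v.                                   *)
Definition code_input (n : nat) (w : n.-tuple (word n)) (u v : word n)
    : 4.-tuple nat :=
  [tuple n; code_words w; code_word u; code_word v].

(* Main.v *)
Require Import Defs.
From HB Require Import structures.
From mathcomp Require Import all_boot all_order all_algebra all_fingroup.
From mathcomp Require Import all_solvable all_field.
From mathcomp Require Import boolp ring lra zify.

(** The free group on n letters acts on the noncommutative power series in n
variables (functions on [seq 'I_n]), the letter i acting as left multiplication
by 1 + X_i (Magnus); two words are equal in the free group iff they act alike.
An endomorphism f acts linearly on the series truncated in degree c, by an
integer matrix T_c with (T_c)^k (u) = f^k(u) in every degree <= c.

- The images f^i(F) are free of nonincreasing rank (Schreier transversals), and
  f is injective on f^i(F) as soon as the rank does not drop (Hopf), hence on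
  f^n(F). So it suffices to solve f^k(u) = v with u, v in f^n(F), and the
  symmetric problem.
- There is M, depending only on the abelianization of f mod 3, such that a vector
  which is T_c-periodic for some c has period M: on the graded pieces, (T_c)^M is
  idempotent mod 3, and an automorphism of finite order which is 1 mod 3 is 1.
- If f^M(v) = v, then k can be reduced below M. Otherwise choose c so large that
  f^M(v) and v differ in degree <= c. Then v is not T_c-periodic, and k is bounded
  by an effective form of the orbit problem of Kannan and Lipton for T_c: if k
  were huge, the eigenvalues of T_c seen by u would be so small that, by
  Kronecker's pigeonhole argument, they are 0 or roots of unity, and then
  (T_c)^k (u) either is periodic or grows linearly in k.

All bounds are explicit, so a brute force search decides the problem. *)

Set Implicit Arguments.
Unset Strict Implicit.
Unset Printing Implicit Defensive.

Import Order.TTheory GRing.Theory Num.Theory.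

(** * The Magnus action *)

Section Magnus.
Variable n : nat.
Local Open Scope ring_scope.
Implicit Types (w : word n) (a b : seq 'I_n -> int) (W : seq 'I_n).

(** Truncation makes the problem linear, but the size of T_c grows with c, and c can be chosen only
    after M, since it must separate f^M(v) from v; a period read off T_c itself would make the
    choice circular. The way out: T_c is block triangular for the degree, and its diagonal blocks
    are tensor powers of the n by n matrix of exponent sums, so one congruence for that matrix
    reaches every c at once. The modulus is 3 and not 2 because -1 is congruent to 1 mod 2 and has
    order 2.

    Truncation is harmless because a nontrivial word of length l already differs from 1 in some
    degree at most l, so bounds on word lengths give c.

    Injectivity on f^n(F) serves to cancel powers of f: to pass from a pair (p, q) with q <= p to (p
    - q, 0), and from f^k(u) = v = f^M(v) to f^(k-M)(u) = v.

    Words act on series instead of being mapped to series, which dispenses with a product of power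
    series and turns inversion into a structural recursion. *)

Definition letter_inv (l : 'I_n * bool) := (l.1, ~~ l.2).
Definition word_inv w : word n := rev (map letter_inv w).

Definition mul_gen (i : 'I_n) a W : int :=
  a W + (if W is j :: W2 then if j == i then a W2 else 0 else 0).

(** The inverse solves [c = a - X_i c]; recursion on the monomial sums the geometric series of (1 +
    X_i)^-1. *)
Fixpoint mul_gen_inv (i : 'I_n) a W : int :=
  a W - (if W is j :: W2 then if j == i then mul_gen_inv i a W2 else 0 else 0).

Definition mul_letter (l : 'I_n * bool) a :=
  if l.2 then mul_gen_inv l.1 a else mul_gen l.1 a.

Definition magnus w a := foldr mul_letter a w.

Lemma magnus_cons l w a : magnus (l :: w) a = mul_letter l (magnus w a).
Proof. by []. Qed.

(** The series 1, so that [magnus w delta0] is the Magnus expansion of [w]. *)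
Definition delta0 W : int := (W == [::])%:R.

Definition weq w1 w2 := magnus w1 = magnus w2.

Lemma letter_invK : involutive letter_inv.
Proof. by case=> i b; rewrite /letter_inv /= negbK. Qed.

Lemma word_invK : involutive word_inv.
Proof. by move=> w; rewrite /word_inv map_rev revK mapK //; exact: letter_invK. Qed.

Lemma word_inv_cat w1 w2 : word_inv (w1 ++ w2) = word_inv w2 ++ word_inv w1.
Proof. by rewrite /word_inv map_cat rev_cat. Qed.

Lemma size_word_inv w : size (word_inv w) = size w.
Proof. by rewrite size_rev size_map. Qed.

Lemma mul_genK i a : mul_gen_inv i (mul_gen i a) = a.
Proof.
apply/funext; elim=> [|j W IH] /=; first by rewrite /mul_gen addr0 subr0.
by rewrite {1}/mul_gen; case: eqP => _; rewrite ?IH ?subr0 ?addr0 ?addrK.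
Qed.

Lemma mul_gen_invK i a : mul_gen i (mul_gen_inv i a) = a.
Proof.
apply/funext; rewrite /mul_gen; case=> [|j W] /=; first by rewrite subr0 addr0.
by case: eqP => _; rewrite ?subr0 ?addr0 ?subrK.
Qed.

Lemma mul_letterK l a : mul_letter l (mul_letter (letter_inv l) a) = a.
Proof.
by case: l => i [] /=; rewrite /mul_letter /=; [exact: mul_genK|exact: mul_gen_invK].
Qed.

Lemma magnus_cat w1 w2 a : magnus (w1 ++ w2) a = magnus w1 (magnus w2 a).
Proof. by rewrite /magnus foldr_cat. Qed.

Lemma magnusK w a : magnus w (magnus (word_inv w) a) = a.
Proof.
elim: w a => //= l w IH a; rewrite /word_inv /= rev_cons -cats1 magnus_cat /= IH.
exact: mul_letterK.
Qed.

Lemma magnus_invK w a : magnus (word_inv w) (magnus w a) = a.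
Proof. by rewrite -{2}(word_invK w) magnusK. Qed.

Lemma weq_cat w1 w2 w1' w2' : weq w1 w1' -> weq w2 w2' -> weq (w1 ++ w2) (w1' ++ w2').
Proof. by rewrite /weq => e1 e2; apply/funext => a; rewrite !magnus_cat e1 e2. Qed.

Lemma weq_inv w w' : weq w w' -> weq (word_inv w) (word_inv w').
Proof.
rewrite /weq => e; apply/funext => a.
by rewrite -{1}(magnusK w' a) -e magnus_invK.
Qed.

Lemma weq_catV w w' : weq (w ++ word_inv w') [::] <-> weq w w'.
Proof.
rewrite /weq; split=> e; apply/funext => a.
  by rewrite -{1}(magnus_invK w' a) -magnus_cat e.
by rewrite magnus_cat e magnusK.
Qed.

Lemma weq_Vcat w w' : weq (word_inv w' ++ w) [::] <-> weq w w'.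
Proof.
rewrite /weq; split=> e; apply/funext => a.
  by rewrite -[in LHS](magnusK w' (magnus w a)) -[magnus (word_inv _) _]magnus_cat e.
by rewrite magnus_cat e magnus_invK.
Qed.

Lemma weq_catVr w : weq (w ++ word_inv w) [::].
Proof. by apply/weq_catV. Qed.

Lemma weq_catVl w : weq (word_inv w ++ w) [::].
Proof. by apply/weq_Vcat. Qed.

Lemma mul_letter_local m l a b :
  (forall W, (size W <= m)%N -> a W = b W) ->
  forall W, (size W <= m)%N -> mul_letter l a W = mul_letter l b W.
Proof.
move=> e; case: l => i [] /=; rewrite /mul_letter /= => W.
  elim: W => [|j W IH] hW /=; first by rewrite e.
  by rewrite e // IH // ltnW.
rewrite /mul_gen => hW; rewrite e //; case: W hW => // j W hW.
by rewrite e // ltnW.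
Qed.

Lemma magnus_local m w a b :
  (forall W, (size W <= m)%N -> a W = b W) ->
  forall W, (size W <= m)%N -> magnus w a W = magnus w b W.
Proof. by move=> e; elim: w => //= l w IH; apply: mul_letter_local. Qed.

(** A letter minus 1 has no constant term, hence raises degrees: its output in degree at most [m]
    sees only the input in degree below [m]. *)
Lemma mul_letter_strict m l a b :
  (forall W, (size W < m)%N -> a W = b W) ->
  forall W, (size W <= m)%N -> mul_letter l a W - a W = mul_letter l b W - b W.
Proof.
move=> e [|j W] /= hW.
  by case: l => i []; rewrite /mul_letter /= /mul_gen /= ?addr0 ?subr0 !subrr.
have := @mul_letter_local m.-1 l a b.
case: l => i [] /=; rewrite /mul_letter /= /mul_gen => H; rewrite ![_ - (a _)]addrC ![_ - (b _)]addrC !addKr.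
  by case: ifP => // _; rewrite H //; [move=> V hV; apply: e; lia|lia].
by case: ifP => // _; apply: e; lia.
Qed.

Lemma magnus_strict m w a b :
  (forall W, (size W < m)%N -> a W = b W) ->
  forall W, (size W <= m)%N -> magnus w a W - a W = magnus w b W - b W.
Proof.
move=> e; elim: w => [|l w IH] W hW /=; first by rewrite !subrr.
have e1 V : (size V < m)%N -> magnus w a V = magnus w b V.
  by move=> hV; have := IH V (ltnW hV); rewrite e // => /addIr.
by rewrite -(subrKA (magnus w a W)) (mul_letter_strict l e1 hW) IH // subrKA.
Qed.

Lemma magnus_nil w a : magnus w a [::] = a [::].
Proof.
elim: w => //= l w <-; case: l => i [];
by rewrite /mul_letter /= /mul_gen ?subr0 ?addr0.
Qed.

Lemma mul_letter_lin (I : Type) (r : seq I) (c : I -> int) (f : I -> seq 'I_n -> int) l :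
  mul_letter l (fun W => \sum_(k <- r) c k * f k W) =
  (fun W => \sum_(k <- r) c k * mul_letter l (f k) W).
Proof.
apply/funext; case: l => i [] W; rewrite /mul_letter /=.
  elim: W => [|j W IH] /=; first by rewrite subr0; apply: eq_bigr => k _; rewrite subr0.
  case: ifP => ji; last by rewrite subr0; apply: eq_bigr => k _; rewrite subr0.
  by rewrite IH -sumrB; apply: eq_bigr => k _; rewrite mulrBr.
rewrite /mul_gen; case: W => [|j W] /=; first by rewrite addr0; apply: eq_bigr => k _; rewrite addr0.
case: ifP => ji; last by rewrite addr0; apply: eq_bigr => k _; rewrite addr0.
by rewrite -big_split; apply: eq_bigr => k _; rewrite mulrDr.
Qed.

Lemma magnus_lin (I : Type) (r : seq I) (c : I -> int) (f : I -> seq 'I_n -> int) w :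
  magnus w (fun W => \sum_(k <- r) c k * f k W) =
  (fun W => \sum_(k <- r) c k * magnus w (f k) W).
Proof. by elim: w => //= l w ->; rewrite mul_letter_lin. Qed.

Definition headneq (i : 'I_n) W := if W is j :: _ then j != i else true.

Lemma mul_letter_other l a W : headneq l.1 W -> mul_letter l a W = a W.
Proof.
case: l W => i [] [|j W] /=; rewrite /mul_letter /= /mul_gen ?subr0 ?addr0 //;
by move=> /negbTE ->; rewrite ?subr0 ?addr0.
Qed.

Lemma mul_letter_head l a W :
  headneq l.1 W -> mul_letter l a (l.1 :: W) = a (l.1 :: W) + (-1) ^+ l.2 * a W.
Proof.
move=> h; have := mul_letter_other a h; case: l h => i [] h; rewrite /mul_letter /=.
  by move=> ->; rewrite eqxx expr1 mulN1r.
by rewrite /mul_gen eqxx expr0 mul1r.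
Qed.

(** For a reduced word x_i1^e1 ... x_ik^ek with consecutive indices distinct, this is the monomial
    X_i1 ... X_ik, whose coefficient in the Magnus expansion is e1 ... ek, hence nonzero. *)
Fixpoint syllables w : seq 'I_n :=
  if w is l :: w' then
    if headneq l.1 (syllables w') then l.1 :: syllables w' else syllables w'
  else [::].

Definition alternating W := sorted (fun i j => j != i) W.

Definition reduced w := sorted (fun l l' : 'I_n * bool => l' != letter_inv l) w.

Lemma syllables_cons l w : exists S, syllables (l :: w) = l.1 :: S.
Proof.
move=> /=; case: (syllables w) => [|j S] /=; first by exists [::].
by case: eqP => [->|_] /=; [exists S|exists (j :: S)].
Qed.

Lemma alternating_head i W : alternating (i :: W) -> headneq i W /\ alternating W.
Proof. by case: W => //= j W /andP[]. Qed.

Lemma syllables_alternating w : alternating (syllables w).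
Proof.
elim: w => //= l w IH; case: ifP => //.
by move: IH; case: (syllables w) => //= j S -> ->.
Qed.

Lemma size_syllables w : (size (syllables w) <= size w)%N.
Proof. by elim: w => //= l w IH; case: ifP => //= _; exact: leqW. Qed.

(** An alternating monomial can take at most one variable from each syllable. The second alternative
    says that the first syllable contributes nothing, so that too few syllables remain. *)
Lemma magnus_vanish w W : alternating W ->
  (size (syllables w) < size W)%N ||
    (if w is l :: _ then headneq l.1 W && (size (syllables w) <= size W)%N else false) ->
  magnus w delta0 W = 0.
Proof.
elim: w W => [|l w IH] W altW.
  by rewrite orbF /= /delta0; case: W altW.
case: (boolP (headneq l.1 W)) => hl hs.
  have {}hs : (size (syllables (l :: w)) <= size W)%N by case/orP: hs => // /ltnW.
  rewrite magnus_cons mul_letter_other //; apply: IH => //.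
  move: hs => /=; case: ifP => /= h hs; first by rewrite hs.
  case: w h hs => // l' w h.
  have [S eS] := syllables_cons l' w.
  by move: h; rewrite eS /= => /negbT; rewrite negbK => /eqP ->; rewrite hl => ->; rewrite orbT.
rewrite orbF in hs; case: W altW hl hs => // j W altW; rewrite [headneq _ _]/=; rewrite negbK => /eqP ej; subst j.
have [hW altW'] := alternating_head altW.
move=> hs; rewrite magnus_cons mul_letter_head // IH ?add0r //; last first.
  by apply/orP; left; move: hs => /=; case: ifP => _ /=; lia.
rewrite IH ?mulr0 //; move: hs => /=; case: ifP => /= h hs; first by apply/orP; left.
case: w {IH} h hs => [|l' w] h; first by [].
have [S eS] := syllables_cons l' w.
by move: h; rewrite eS /= => /negbT; rewrite negbK => /eqP ->; rewrite hW ltnS => ->; rewrite orbT.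
Qed.

(** [k.+1] is the length of the first syllable; with its sign it is the coefficient of X in (1 +
    X)^e. In the induction a new letter either lengthens this syllable or opens another one. *)
Lemma magnus_syllables l w : reduced (l :: w) ->
  exists S (k : nat), [/\ syllables (l :: w) = l.1 :: S, magnus (l :: w) delta0 S != 0 &
    magnus (l :: w) delta0 (l.1 :: S) = (-1) ^+ l.2 * k.+1%:R * magnus (l :: w) delta0 S].
Proof.
elim: w l => [|l' w IH] l red.
  exists [::], 0%N; split=> //; first by rewrite magnus_cons mul_letter_other.
  by rewrite !magnus_cons mul_letter_head // [mul_letter _ _ [::]]mul_letter_other //= /delta0 /= add0r !mulr1.
have [ll' red'] : l' != letter_inv l /\ reduced (l' :: w) by apply/andP.
have [S [k [eS nz ek]]] := IH l' red'.
have := syllables_alternating (l' :: w); rewrite eS => /alternating_head[hS _].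
have [e1|ne] := eqVneq l'.1 l.1.
  (* Reducedness forbids opposite signs inside a syllable. *)
  have el : l' = l.
    move: e1 ll'; rewrite /letter_inv; case: (l) => i b; case: (l') => i' b' /= ->.
    by move=> h; congr (_, _); case: b b' h => [] [] //; rewrite eqxx.
  subst l'; exists S, k.+1; split; first by rewrite [LHS]/= -/(syllables (l :: w)) eS /= eqxx.
    by rewrite magnus_cons mul_letter_other.
  rewrite magnus_cons mul_letter_head // ek.
  by rewrite [mul_letter _ _ S]mul_letter_other // -[k.+2]addn1 natrD mulrDr mulrDl mulr1.
exists (l'.1 :: S), 0%N; split.
- by rewrite [LHS]/= -/(syllables (l' :: w)) eS /= ne.
- rewrite magnus_cons mul_letter_other // ek.
  by rewrite !mulf_neq0 // ?signr_eq0 ?pnatr_eq0.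
- rewrite magnus_cons mul_letter_head //.
  rewrite magnus_vanish ?add0r ?mulr1 ?[mul_letter _ _ (_ :: S)]mul_letter_other //.
    by have := syllables_alternating (l' :: w); rewrite eS /= ne.
  by rewrite eS /= ltnSn.
Qed.

Lemma magnus_reduced w : reduced w -> w != [::] ->
  exists2 W, (0 < size W <= size w)%N & magnus w delta0 W != 0.
Proof.
case: w => // l w red _; have [S [k [eS nz ek]]] := magnus_syllables red.
exists (l.1 :: S); first by rewrite -eS size_syllables eS.
by rewrite ek !mulf_neq0 // ?signr_eq0 ?pnatr_eq0.
Qed.

End Magnus.

(** * Free reduction and the word problem *)

Section Reduction.
Variable n : nat.
Implicit Types (w st : word n).

(** [st] is a stack: the reduced form of the prefix already read, with its last letter on top. This
    explains the [rev] in the lemmas below. *)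
Definition push st (l : 'I_n * bool) : word n :=
  if st is l' :: st' then if l' == letter_inv l then st' else l :: st else [:: l].

Lemma reduced_push st l : reduced st -> reduced (push st l).
Proof.
case: st => //= l' st red; case: eqP => [_|/eqP ne].
  by move: red; rewrite /reduced /=; case: st => //= l2 st /andP[].
by rewrite /reduced /= ne.
Qed.

Lemma weq_push st l : weq (rev (push st l)) (rev st ++ [:: l]).
Proof.
case: st => //= l' st; case: eqP => [->|_]; last by rewrite [rev (l :: _)]rev_cons -cats1.
rewrite rev_cons -cats1 -catA /=; apply/funext => a.
by have := mul_letterK (letter_inv l) a; rewrite letter_invK magnus_cat /= => ->.
Qed.

Lemma size_push st l : (size (push st l) <= (size st).+1)%N.
Proof. by case: st => //= l' st; case: ifP => // _; rewrite leqW. Qed.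

Definition reduce w := foldl push [::] w.

Lemma weq_foldl_push st w : weq (rev (foldl push st w)) (rev st ++ w).
Proof.
elim: w st => [|l w IH] st /=; first by rewrite cats0.
rewrite /weq IH -cat1s catA.
by apply: (weq_cat (weq_push st l)).
Qed.

Lemma weq_reduce w : weq (rev (reduce w)) w.
Proof. exact: weq_foldl_push. Qed.

Lemma reduced_reduce w : reduced (rev (reduce w)).
Proof.
have : reduced (reduce w).
  rewrite /reduce; move: (isT : reduced (Nil ('I_n * bool))); elim: w [::] => //= l w IH st red.
  exact/IH/reduced_push.
rewrite /reduced rev_sorted; apply: sub_sorted => l l'; apply: contraNN => /eqP ->.
by rewrite letter_invK.
Qed.

Lemma size_reduce w : (size (reduce w) <= size w)%N.
Proof.
rewrite /reduce -[size w]add0n -[0%N]/(size (Nil ('I_n * bool))).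
elim: w [::] => [|l w IH] st /=; first by rewrite addn0.
by apply: leq_trans (IH _) _; rewrite addnS -addSn leq_add2r size_push.
Qed.

(** A nonempty reduced form has a nonzero coefficient in positive degree at most its length, so
    degrees up to [size w] suffice. All later choices of the truncation degree rest on this. *)
Lemma weq_nil_delta w :
  (forall W, (size W <= size w)%N -> magnus w (@delta0 n) W = delta0 W) -> reduce w = [::].
Proof.
move=> H; apply/eqP; case: (boolP (reduce w == [::])) => // ne.
have ne' : rev (reduce w) != [::].
  by apply: contraNN ne => /eqP e; rewrite -(revK (reduce w)) e.
have [W /andP[W0 sW]] := magnus_reduced (reduced_reduce w) ne'.
rewrite weq_reduce H; first by rewrite /delta0; case: W W0 {sW}.
by rewrite (leq_trans sW) // size_rev size_reduce.
Qed.

Lemma weq_nilP w : weq w [::] <-> reduce w = [::].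
Proof.
split=> [e|e]; last by rewrite /weq -(weq_reduce w) e.
by apply: weq_nil_delta => W _; rewrite e.
Qed.

Lemma weq_nil_cancel w : weq w [::] -> w <> [::] ->
  exists w1 l w2, w = w1 ++ l :: letter_inv l :: w2.
Proof.
move=> /weq_nilP e ne; case: (boolP (reduced w)) => red.
  have [|W /andP[W0 _]] := magnus_reduced red; first exact/eqP.
  by have /weq_nilP -> := e; rewrite /delta0; case: W W0.
elim: w red {e ne} => //= l [//|l' w] IH; rewrite /reduced /= negb_and negbK.
case/orP=> [/eqP ->|red]; first by exists [::], l, w.
have [w1 [l2 [w2 ->]]] := IH red.
by exists (l :: w1), l2, w2.
Qed.
End Reduction.

(** * Substitutions and their linear extension to truncated series *)

Definition subst m n (b : 'I_m -> word n) (w : word m) : word n :=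
  flatten [seq (if l.2 then word_inv (b l.1) else b l.1) | l <- w].

Lemma subst_cat m n (b : 'I_m -> word n) w1 w2 : subst b (w1 ++ w2) = subst b w1 ++ subst b w2.
Proof. by rewrite /subst map_cat flatten_cat. Qed.

Lemma subst_inv m n (b : 'I_m -> word n) w : subst b (word_inv w) = word_inv (subst b w).
Proof.
elim: w => //= l w IH; rewrite /word_inv /= rev_cons -cats1 subst_cat.
rewrite -[rev _]/(word_inv w) IH /subst /= -/(subst b w) -[RHS]/(word_inv _) word_inv_cat cats0.
by congr (_ ++ _); case: l => i []; rewrite //= word_invK.
Qed.

Lemma subst_subst m n p (a : 'I_m -> word n) (b : 'I_n -> word p) w :
  subst b (subst a w) = subst (fun i => subst b (a i)) w.
Proof.
elim: w => //= l w IH; rewrite {2}/subst /= subst_cat IH; congr (_ ++ _).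
by case: l.2; rewrite ?subst_inv.
Qed.

Section Monomials.
Local Open Scope ring_scope.

Fixpoint mons n c : seq (seq 'I_n) :=
  [::] :: if c is c'.+1 then [seq i :: W | i <- enum 'I_n, W <- mons n c'] else [::].

Lemma mem_mons n c W : (W \in mons n c) = (size W <= c)%N.
Proof.
elim: c W => [|c IH] [|i W] //=; rewrite inE /=.
apply/allpairsP/idP => [[[j V] /= [_ hV [_ ->]]]|hW]; first by rewrite ltnS -IH.
by exists (i, W); rewrite mem_enum IH.
Qed.

Lemma uniq_mons n c : uniq (mons n c).
Proof.
elim: c => //= c IH; apply/andP; split; first by apply/allpairsP => -[[j V] []].
by apply: allpairs_uniq => //; [exact: enum_uniq|move=> [i V] [j U] _ _ [-> ->]].
Qed.

Lemma size_mons n c : size (mons n c) = iter c (fun z => (n * z).+1)%N 1%N.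
Proof. by elim: c => //= c <-; rewrite size_allpairs size_enum_ord. Qed.

Lemma sum_mons n c (F : seq 'I_n -> int) :
  \sum_(V <- mons n c.+1) F V = F [::] + \sum_(i < n) \sum_(V <- mons n c) F (i :: V).
Proof. by rewrite /= big_cons big_allpairs_dep /= big_enum. Qed.

Variables (m n : nat).
Implicit Types (b : 'I_m -> word n) (a : seq 'I_m -> int).

(* The image of the monomial V under X_i |-> b_i - 1. *)
Definition mon_img b (V : seq 'I_m) : seq 'I_n -> int :=
  foldr (fun i (f : seq 'I_n -> int) W => magnus (b i) f W - f W) (@delta0 n) V.

(** Meaningful in degrees at most [c] only: [mon_img b V] vanishes below degree [size V], so the
    omitted monomials do not reach those degrees. *)
Definition lin_ext b c a : seq 'I_n -> int :=
  fun W => \sum_(V <- mons m c) a V * mon_img b V W.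

Lemma magnus0 w : magnus w (fun=> 0) = (fun=> 0) :> (seq 'I_n -> int).
Proof.
have := magnus_lin [::] (fun=> 0) (fun _ : nat => (fun=> 0)) w.
by rewrite (_ : (fun W => _) = (fun=> 0)) => [->|]; apply/funext => W; rewrite big_nil.
Qed.

Lemma magnus_low s w (f : seq 'I_n -> int) : (forall W, (size W < s)%N -> f W = 0) ->
  forall W, (size W <= s)%N -> magnus w f W = f W.
Proof.
move=> f0 W sW; have := @magnus_strict n s w f (fun=> 0) f0 W sW.
by rewrite magnus0 subrr => /eqP; rewrite subr_eq0 => /eqP.
Qed.

Lemma mon_img_low b V W : (size W < size V)%N -> mon_img b V W = 0.
Proof.
elim: V W => //= i V IH W sW; apply/eqP; rewrite subr_eq0; apply/eqP.
exact: (@magnus_low (size V)).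
Qed.

(** Since [w - 1] has no constant term and [f] starts in degree [s], only the linear part of [w]
    times the degree [s] part of [f] reaches degree [s + 1]. The linear part of [w] consists of its
    exponent sums. *)
Lemma magnus_lead s w (f : seq 'I_n -> int) j W : (forall W, (size W < s)%N -> f W = 0) ->
  size W = s -> magnus w f (j :: W) - f (j :: W) = magnus w (@delta0 n) [:: j] * f W.
Proof.
move=> f0 sW; elim: w => [|l w IH]; first by rewrite /= subrr mul0r.
have g0 V : (size V < s)%N -> magnus w f V = 0.
  by move=> sV; rewrite (magnus_low w f0) ?f0 // ltnW.
have gW : magnus w f W = f W by apply: (magnus_low w f0); rewrite sW.
have hW : mul_letter l (magnus w f) W = f W.
  by rewrite -magnus_cons (magnus_low _ f0) // sW.
rewrite !magnus_cons -(subrKA (magnus w f (j :: W))) IH.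
rewrite -[in RHS](subrK (magnus w (@delta0 n) [:: j]) (mul_letter l _ [:: j])) mulrDl.
congr (_ + _).
move: hW; case: l => i []; rewrite /mul_letter /= => hW; rewrite ?/mul_gen ?subr0.
  by rewrite hW magnus_nil; case: eqP => _; rewrite ?/delta0 /=; ring.
by rewrite gW magnus_nil; case: eqP => _; rewrite ?/delta0 /=; ring.
Qed.

(** Iterated over the letters of a monomial, this identifies the diagonal blocks of [mx_ext] with
    the tensor powers of the matrix of exponent sums. *)
Lemma mon_img_lead b i V j W : size W = size V ->
  mon_img b (i :: V) (j :: W) = magnus (b i) (@delta0 n) [:: j] * mon_img b V W.
Proof. by move=> sW; apply: magnus_lead sW => U; apply: mon_img_low. Qed.

Lemma lin_extS b c a W : lin_ext b c.+1 a W = a [::] * delta0 W +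
  \sum_(i < m) (magnus (b i) (lin_ext b c (fun V => a (i :: V))) W -
                lin_ext b c (fun V => a (i :: V)) W).
Proof.
rewrite /lin_ext sum_mons /=; congr (_ + _); apply: eq_bigr => i _.
by rewrite magnus_lin -sumrB; apply: eq_bigr => V _; rewrite mulrBr.
Qed.

Lemma lin_ext_stable b c a W : (size W <= c)%N -> lin_ext b c.+1 a W = lin_ext b c a W.
Proof.
elim: c a W => [|c IH] a W sW.
  rewrite lin_extS big1 ?addr0; first by rewrite /lin_ext big_seq1.
  by move=> i _; case: W sW => // _; rewrite magnus_nil subrr.
rewrite !lin_extS; congr (_ + _); apply: eq_bigr => i _.
(* [b i - 1] raises degrees, so agreement of the inner sums in degree at most [c] gives agreement in
   degree [c.+1]. *)
by apply: (@magnus_strict _ c.+1) => // V sV; exact: IH.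
Qed.

Lemma lin_ext_sub b c a a' W :
  lin_ext b c (fun V => a V - a' V) W = lin_ext b c a W - lin_ext b c a' W.
Proof. by rewrite /lin_ext -sumrB; apply: eq_bigr => V _; rewrite mulrBl. Qed.

Lemma lin_ext_mul_gen b c i a W : (size W <= c)%N ->
  lin_ext b c (mul_gen i a) W = magnus (b i) (lin_ext b c a) W.
Proof.
case: c => [|c] sW.
  by case: W sW => // _; rewrite magnus_nil /lin_ext !big_seq1 /mul_gen addr0.
have -> : lin_ext b c.+1 (mul_gen i a) W = lin_ext b c.+1 a W +
    (magnus (b i) (lin_ext b c a) W - lin_ext b c a W).
  rewrite {1 2}/lin_ext /mul_gen !sum_mons /= addr0 -addrA; congr (_ + _).
  under eq_bigr => j _ do under eq_bigr => V _ do rewrite mulrDl.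
  under eq_bigr => j _ do rewrite big_split /=.
  rewrite big_split /=; congr (_ + _); rewrite (bigD1 i) //= eqxx [X in _ + X]big1 => [|j /negbTE ji].
    by rewrite addr0 magnus_lin -sumrB; apply: eq_bigr => V _; rewrite mulrBr.
  by rewrite ji; apply: big1 => V _; rewrite mul0r.
rewrite (_ : magnus (b i) (lin_ext b c a) W - lin_ext b c a W =
   magnus (b i) (lin_ext b c.+1 a) W - lin_ext b c.+1 a W); first by rewrite addrC subrK.
by apply: (@magnus_strict _ c.+1) => // V sV; rewrite lin_ext_stable.
Qed.

Lemma lin_ext_magnus b c g a W : (size W <= c)%N ->
  lin_ext b c (magnus g a) W = magnus (subst b g) (lin_ext b c a) W.
Proof.
elim: g W => //= -[i s] g IH W sW; rewrite /subst /= -/(subst b g) magnus_cat.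
rewrite -(magnus_local _ IH) //; case: s; rewrite /mul_letter /=; last exact: lin_ext_mul_gen.
set f := magnus g a.
(* An inverse letter is handled by applying the case of a positive letter to [mul_gen_inv i f] and
   then undoing [b i]. *)
have H V : (size V <= c)%N -> lin_ext b c f V = magnus (b i) (lin_ext b c (mul_gen_inv i f)) V.
  by move=> sV; rewrite -lin_ext_mul_gen // mul_gen_invK.
by rewrite (magnus_local _ H) // magnus_invK.
Qed.

Lemma lin_ext_delta b c W : lin_ext b c (@delta0 m) W = delta0 W.
Proof.
case: c => [|c]; first by rewrite /lin_ext big_seq1 mul1r.
rewrite /lin_ext sum_mons mul1r big1 ?addr0 // => i _.
by apply: big1 => V _; rewrite mul0r.
Qed.

Lemma lin_ext_word b c g W : (size W <= c)%N ->
  lin_ext b c (magnus g (@delta0 m)) W = magnus (subst b g) (@delta0 n) W.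
Proof.
move=> sW; rewrite lin_ext_magnus //; apply: (@magnus_local _ c) => // V _.
exact: lin_ext_delta.
Qed.

Lemma eq_mon_img b b' : (forall i, weq (b i) (b' i)) -> mon_img b =1 mon_img b'.
Proof. by move=> e; elim=> //= i V IH; rewrite IH e. Qed.

(** Rectangular, so that free groups of different ranks can be compared; it acts on row vectors, so
    composition of substitutions reads from left to right. *)
Definition mx_ext b c := \matrix_(i < size (mons m c), j < size (mons n c))
  mon_img b (nth [::] (mons m c) i) (nth [::] (mons n c) j).

End Monomials.

(** * Matrices of truncated substitutions *)

Section MonomialMatrices.
Local Open Scope ring_scope.

Definition vec n c (f : seq 'I_n -> int) := \row_(j < size (mons n c)) f (nth [::] (mons n c) j).

Lemma size_nth_mons n c (j : 'I_(size (mons n c))) : (size (nth [::] (mons n c) j) <= c)%N.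
Proof. by rewrite -mem_mons mem_nth. Qed.

Lemma vec_inj n c (f f' : seq 'I_n -> int) : vec c f = vec c f' ->
  forall W, (size W <= c)%N -> f W = f' W.
Proof.
move=> e W sW; have hW : (index W (mons n c) < size (mons n c))%N by rewrite index_mem mem_mons.
by have /rowP/(_ (Ordinal hW)) := e; rewrite !mxE /= nth_index ?mem_mons.
Qed.

Lemma eq_vec n c (f f' : seq 'I_n -> int) :
  (forall W, (size W <= c)%N -> f W = f' W) -> vec c f = vec c f'.
Proof. by move=> e; apply/rowP => j; rewrite !mxE e // size_nth_mons. Qed.

Lemma vec_mx_ext m n (b : 'I_m -> word n) c a :
  vec c a *m mx_ext b c = vec c (lin_ext b c a).
Proof.
apply/rowP => j; rewrite !mxE /lin_ext (big_nth [::]) big_mkord.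
by apply: eq_bigr => i _; rewrite !mxE.
Qed.

Definition wvec n c (w : word n) := vec c (magnus w (@delta0 n)).

Lemma wvec_subst m n (b : 'I_m -> word n) c w :
  wvec c (subst b w) = wvec c w *m mx_ext b c.
Proof. by rewrite vec_mx_ext; apply: eq_vec => W sW; rewrite lin_ext_word. Qed.

Lemma eq_mx_ext m n (b b' : 'I_m -> word n) c :
  (forall i, weq (b i) (b' i)) -> mx_ext b c = mx_ext b' c.
Proof. by move=> e; apply/matrixP => i j; rewrite !mxE (eq_mon_img e). Qed.

Lemma mx_ext_comp m n p (a : 'I_m -> word n) (b : 'I_n -> word p) c :
  mx_ext a c *m mx_ext b c = mx_ext (fun i => subst b (a i)) c.
Proof.
apply/row_matrixP => i; rewrite row_mul.
have -> : row i (mx_ext a c) = vec c (mon_img a (nth [::] (mons m c) i)).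
  by apply/rowP => j; rewrite !mxE.
rewrite vec_mx_ext; set V := nth _ _ _.
have -> : row i (mx_ext (fun i => subst b (a i)) c) = vec c (mon_img (fun i => subst b (a i)) V).
  by apply/rowP => j; rewrite !mxE.
apply: eq_vec; elim: V => [|k V IH] W sW /=; first exact: lin_ext_delta.
by rewrite lin_ext_sub lin_ext_magnus // IH // (magnus_local _ IH).
Qed.

Definition letters n (i : 'I_n) : word n := [:: (i, false)].

Lemma subst_letters n (w : word n) : subst (@letters n) w = w.
Proof. by elim: w => // -[i []] w IH; rewrite /subst /= -/(subst _ _) IH. Qed.

Lemma mx_ext_letters n c : mx_ext (@letters n) c = 1%:M.
Proof.
apply/matrixP => i j; rewrite !mxE -(inj_eq val_inj) -(nth_uniq [::] (ltn_ord i) (ltn_ord j) (uniq_mons n c)).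
move: (nth _ _ i) (nth _ _ j); elim=> [|k V IH] W /=.
  by rewrite /delta0 eq_sym.
rewrite /mul_letter /= /mul_gen addrC addKr; case: W => //= k' W; rewrite eqseq_cons IH [k == k']eq_sym.
by case: eqP.
Qed.

Lemma mx_ext_iter n (b : 'I_n -> word n) c k :
  mx_ext (fun i => iter k (subst b) (letters i)) c = mx_ext b c ^+ k.
Proof.
elim: k => [|k IH]; first exact: mx_ext_letters.
by rewrite exprSr -IH -[_ * _]/(_ *m _) mx_ext_comp.
Qed.

Lemma iter_subst n (b : 'I_n -> word n) k w :
  iter k (subst b) w = subst (fun i => iter k (subst b) (letters i)) w.
Proof.
elim: k => [|k IH] /=; first by rewrite subst_letters.
by rewrite IH subst_subst.
Qed.

Lemma wvec_iter n (b : 'I_n -> word n) c k w :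
  wvec c (iter k (subst b) w) = wvec c w *m mx_ext b c ^+ k.
Proof. by rewrite iter_subst wvec_subst mx_ext_iter. Qed.

(** Equality of the truncated expansions makes that of [word_inv w' ++ w] trivial up to degree [c],
    which is at least the length of this quotient. *)
Lemma wvec_weq n (w w' : word n) c : (size w + size w' <= c)%N -> wvec c w = wvec c w' ->
  weq w w'.
Proof.
move=> hc e; apply/weq_Vcat/weq_nilP/weq_nil_delta => W sW.
have {}sW : (size W <= c)%N.
  by apply: leq_trans sW (leq_trans _ hc); rewrite size_cat size_word_inv addnC.
by rewrite magnus_cat (magnus_local _ (vec_inj e)) // magnus_invK.
Qed.

End MonomialMatrices.

(** * Subgroups of free groups *)

Section SubgroupWords.

Lemma weq_refl n (w : word n) : weq w w. Proof. by []. Qed.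

Lemma weq_cancel n (w1 w2 : word n) l : weq (w1 ++ l :: letter_inv l :: w2) (w1 ++ w2).
Proof. by apply/funext => a; rewrite !magnus_cat /= mul_letterK. Qed.

(** Triviality is generated by cancellation of adjacent inverse letters. Substitutions, path labels
    and evaluation in a group are shown to respect [weq] through this induction. *)
Lemma weq_nil_ind n (P : word n -> Prop) : P [::] ->
  (forall w1 l w2, P (w1 ++ w2) -> P (w1 ++ l :: letter_inv l :: w2)) ->
  forall w, weq w [::] -> P w.
Proof.
move=> P0 PS w; have [k] := ubnP (size w); elim: k w => // k IH w sw e.
have [->|/eqP ne] := eqVneq w [::]; first exact: P0.
have [w1 [l [w2 ew]]] := weq_nil_cancel e ne; rewrite ew; apply: PS; apply: IH.
  by move: sw; rewrite ew !size_cat /=; lia.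
by rewrite /weq -(weq_cancel w1 w2 l) -ew.
Qed.

Lemma subst_cons m n (b : 'I_m -> word n) l w :
  subst b (l :: w) = (if l.2 then word_inv (b l.1) else b l.1) ++ subst b w.
Proof. by []. Qed.

Lemma weq_subst m n (b : 'I_m -> word n) w w' : weq w w' -> weq (subst b w) (subst b w').
Proof.
move=> /weq_catV e; apply/weq_catV; rewrite -subst_inv -subst_cat.
move: (w ++ _) e; apply: weq_nil_ind => // w1 l w2; rewrite /weq => <-; rewrite !subst_cat !subst_cons.
apply/funext => a; rewrite !magnus_cat; case: l => i [] /=;
by rewrite ?magnus_invK ?magnusK.
Qed.

Lemma weq_substl m n (b b' : 'I_m -> word n) w :
  (forall i, weq (b i) (b' i)) -> weq (subst b w) (subst b' w).
Proof.
move=> e; elim: w => // l w IH; rewrite !subst_cons; apply: weq_cat => //.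
by case: l.2; rewrite //; exact: weq_inv.
Qed.

Definition spanned m n (b : 'I_m -> word n) (w : word n) := exists g, weq w (subst b g).

Definition independent m n (b : 'I_m -> word n) := forall g, weq (subst b g) [::] -> weq g [::].

Lemma spanned_weq m n (b : 'I_m -> word n) w w' : weq w w' -> spanned b w' -> spanned b w.
Proof. by rewrite /weq => e [g eg]; exists g; rewrite /weq e. Qed.

Lemma spanned_nil m n (b : 'I_m -> word n) : spanned b [::].
Proof. by exists [::]. Qed.

Lemma spanned_cat m n (b : 'I_m -> word n) w w' :
  spanned b w -> spanned b w' -> spanned b (w ++ w').
Proof. by move=> [g eg] [g' eg']; exists (g ++ g'); rewrite subst_cat; apply: weq_cat. Qed.

Lemma spanned_inv m n (b : 'I_m -> word n) w : spanned b w -> spanned b (word_inv w).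
Proof. by move=> [g eg]; exists (word_inv g); rewrite subst_inv; apply: weq_inv. Qed.

Lemma spanned_gen m n (b : 'I_m -> word n) i : spanned b (b i).
Proof. by exists [:: (i, false)]; rewrite /subst /= cats0. Qed.

Lemma spanned_trans m m' n (b : 'I_m -> word n) (b' : 'I_m' -> word n) w :
  (forall i, spanned b' (b i)) -> spanned b w -> spanned b' w.
Proof.
move=> H [g eg]; apply: spanned_weq eg _; elim: g => [|l g IH]; first exact: spanned_nil.
rewrite subst_cons; apply: spanned_cat => //; case: l.2; last exact: H.
exact/spanned_inv.
Qed.

End SubgroupWords.

(** * Free bases of finitely generated subgroups from the coset graph *)

Section NielsenSchreier.
Variables (n r : nat) (a : 'I_r -> word n).
Implicit Types (t w s : word n).

Notation H := (spanned a).
Definition coset_eq t t' := H (t ++ word_inv t').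

Lemma coset_refl t : coset_eq t t.
Proof. exact: spanned_weq (weq_catVr t) (spanned_nil a). Qed.

Lemma coset_sym t t' : coset_eq t t' -> coset_eq t' t.
Proof. by move=> /spanned_inv; rewrite word_inv_cat word_invK. Qed.

Lemma coset_trans t t' t'' : coset_eq t t' -> coset_eq t' t'' -> coset_eq t t''.
Proof.
move=> h h'; apply: spanned_weq (spanned_cat h h').
by apply/funext => f; rewrite !magnus_cat magnus_invK.
Qed.

Lemma coset_weq t t' : weq t t' -> coset_eq t t'.
Proof. by move=> /weq_catV e; apply: spanned_weq e (spanned_nil a). Qed.

Lemma coset_cat t t' w : coset_eq t t' -> coset_eq (t ++ w) (t' ++ w).
Proof.
apply: spanned_weq; rewrite word_inv_cat.
by apply/funext => f; rewrite !magnus_cat magnusK.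
Qed.

(* Bijective base 2n+1 numeration: an injective, well-founded order on words
   which is compatible with appending a letter. *)
Definition word_num w := foldl (fun k (l : 'I_n * bool) => k * n.*2.+1 + (l.1.*2 + l.2).+1) 0 w.

Lemma word_num_rcons s l : word_num (rcons s l) = word_num s * n.*2.+1 + (l.1.*2 + l.2).+1.
Proof. by rewrite /word_num foldl_rcons. Qed.

Lemma word_num_inj : injective word_num.
Proof.
have dig (l : 'I_n * bool) : (l.1.*2 + l.2).+1 < n.*2.+1.
  by case: l => i b /=; have := ltn_ord i; case: b => /=; lia.
elim/last_ind=> [|s l IH]; elim/last_ind=> [|s' l' _] //; rewrite ?word_num_rcons.
- by rewrite addnS.
- by rewrite addnS.
move=> e; have : (word_num s * n.*2.+1 + (l.1.*2 + l.2).+1) %% n.*2.+1 =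
    (word_num s' * n.*2.+1 + (l'.1.*2 + l'.2).+1) %% n.*2.+1 by rewrite e.
rewrite !modnMDl !modn_small // => -[el]; move: e; rewrite el => /addIn/eqP.
rewrite eqn_pmul2r // => /eqP/IH ->; congr rcons.
case: l l' el {IH} => i b [i' b'] /= el.
have eb : b = b' by case: b b' el => [] []; lia.
by subst b'; congr (_, _); apply: val_inj => /=; lia.
Qed.

Lemma rep_exists t : exists s, coset_eq s t /\ forall s', coset_eq s' t -> word_num s <= word_num s'.
Proof.
pose P m := `[< exists2 s, word_num s = m & coset_eq s t >].
have exP : exists m, P m by exists (word_num t); apply/asboolP; exists t => //; exact: coset_refl.
case: (ex_minnP exP) => m /asboolP[s <- cs] min; exists s; split=> // s' cs'.
by apply: min; apply/asboolP; exists s'.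
Qed.

Definition rep t := projT1 (cid (rep_exists t)).

Lemma rep_coset t : coset_eq (rep t) t.
Proof. by rewrite /rep; case: cid => s []. Qed.

Lemma rep_min t s : coset_eq s t -> word_num (rep t) <= word_num s.
Proof. by rewrite /rep; case: cid => s' [_ h] /=; exact: h. Qed.

Lemma rep_eq t t' : coset_eq t t' -> rep t = rep t'.
Proof.
move=> h; apply: word_num_inj; apply/eqP; rewrite eqn_leq; apply/andP; split; apply: rep_min.
  exact: coset_trans (rep_coset t') (coset_sym h).
exact: coset_trans (rep_coset t) h.
Qed.

Lemma rep_rep t : rep (rep t) = rep t.
Proof. exact/rep_eq/rep_coset. Qed.

Lemma rep_nil : rep [::] = [::].
Proof.
apply: word_num_inj; apply/eqP; rewrite -leqn0; exact: rep_min (coset_refl [::]).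
Qed.

(** A smaller representative of the coset of [s], followed by [l], would be a smaller representative
    of that of [rcons s l]. Thus least representatives form a prefix-closed (Schreier) transversal,
    a spanning tree of the coset graph. *)
Lemma rep_prefix s l : rep (rcons s l) = rcons s l -> rep s = s.
Proof.
move=> e; apply: word_num_inj; apply/eqP; rewrite eqn_leq rep_min /=; last exact: coset_refl.
have /rep_min : coset_eq (rcons (rep s) l) (rcons s l).
  by rewrite -!cats1; apply: coset_cat; exact: rep_coset.
by rewrite e !word_num_rcons leq_add2r leq_pmul2r.
Qed.

Lemma rep_spanned w : H w -> rep w = [::].
Proof. by move=> h; rewrite -rep_nil; apply: rep_eq; rewrite /coset_eq /= cats0. Qed.

Definition step t l := rep (rcons t l).

Lemma stepK t l : rep t = t -> step (step t l) (letter_inv l) = t.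
Proof.
move=> et; rewrite -[RHS]et; apply: rep_eq.
have h : coset_eq (rcons (step t l) (letter_inv l)) (rcons (rcons t l) (letter_inv l)).
  by rewrite -!cats1; apply: coset_cat; rewrite cats1; exact: rep_coset.
apply: coset_trans h _; apply: coset_weq; rewrite -!cats1 -catA /=.
by have := weq_cancel t [::] l; rewrite cats0.
Qed.

Lemma rep_step t l : rep (step t l) = step t l. Proof. exact: rep_rep. Qed.

Lemma foldl_step t w : rep t = t -> foldl step t w = rep (t ++ w).
Proof.
elim/last_ind: w => [|w l IH] et; first by rewrite cats0.
rewrite foldl_rcons IH // -rcons_cat -!cats1; apply: rep_eq; rewrite cats1.
by rewrite -!cats1; apply: coset_cat; exact: rep_coset.
Qed.

(** The Schreier generator of an edge: reach its origin through the tree, cross it, and return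
    through the tree. *)
Definition edge_word (e : word n * 'I_n) : word n :=
  e.1 ++ (e.2, false) :: word_inv (step e.1 (e.2, false)).

(** Edges are recorded in their positive direction; an inverse letter crosses backwards the edge
    that starts at its endpoint. *)
Definition letter_edge t (l : 'I_n * bool) := (if l.2 then step t l else t, l.1).

Lemma edge_word_spanned e : H (edge_word e).
Proof.
have h : coset_eq (rcons e.1 (e.2, false)) (step e.1 (e.2, false)) by exact/coset_sym/rep_coset.
by move: h; rewrite /coset_eq -cats1 -catA.
Qed.

Lemma weq_letter_edge t l : rep t = t ->
  weq (t ++ l :: word_inv (step t l))
    (if l.2 then word_inv (edge_word (letter_edge t l)) else edge_word (letter_edge t l)).
Proof.
move=> et; case: l => i [] //=; rewrite /edge_word /letter_edge /=.
have -> : step (step t (i, true)) (i, false) = t by rewrite (stepK (i, true)).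
rewrite word_inv_cat -[(i, false) :: _]cat1s word_inv_cat word_invK -catA /=.
by apply/funext => f; rewrite !magnus_cat. 
Qed.

Lemma tree_edge s l : rep (rcons s l) = rcons s l -> weq (edge_word (letter_edge s l)) [::].
Proof.
move=> e; have es := rep_prefix e; have := weq_letter_edge l es.
rewrite {1}/step e -cat1s catA cats1 /weq (weq_catVr (rcons s l)) => h.
by case: l.2 h => h; rewrite // -(word_invK (edge_word _)); exact: (@weq_inv _ _ [::] (esym h)).
Qed.

Section Labels.
Variables (k : nat) (e : 'I_k -> word n * 'I_n).
Hypothesis e_inj : injective e.
Hypothesis e_nontree : forall j, ~ weq (edge_word (e j)) [::].
Hypothesis e_rep : forall j, rep (e j).1 = (e j).1.

Notation b := (fun j => edge_word (e j)).

(** Edges outside the finite list [e] get the empty label, whether in the tree or not. The coset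
    graph may therefore be infinite. *)
Definition label (d : word n * 'I_n) : word k :=
  if [pick j | e j == d] is Some j then [:: (j, false)] else [::].

Definition letter_label t l : word k :=
  if l.2 then word_inv (label (letter_edge t l)) else label (letter_edge t l).

(* The labels read along the path of the coset graph which starts at t and spells w.
   At the trivial coset this inverts [subst b], which proves that b is independent. *)
Fixpoint path_label t w : word k :=
  if w is l :: w' then letter_label t l ++ path_label (step t l) w' else [::].

Lemma path_label_cat t w w' :
  path_label t (w ++ w') = path_label t w ++ path_label (foldl step t w) w'.
Proof. by elim: w t => //= l w IH t; rewrite IH catA. Qed.

Lemma letter_labelK t l : rep t = t ->
  weq (letter_label t l ++ letter_label (step t l) (letter_inv l)) [::].
Proof.
move=> et; rewrite /letter_label /letter_edge; have := stepK l et; rewrite /letter_inv; case: l => i [] /=.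
  by move=> _; exact: weq_catVl.
by move=> ->; exact: weq_catVr.
Qed.

(** Crossing an edge and coming back gives inverse labels, so labelling descends to reduced
    paths. *)
Lemma path_label_weq t w : weq w [::] -> rep t = t -> weq (path_label t w) [::].
Proof.
move=> ew et; move: w ew; apply: weq_nil_ind => // w1 l w2; rewrite {1}/weq => e1; rewrite /weq -e1.
rewrite !path_label_cat; apply: weq_cat => //=.
have er : rep (foldl step t w1) = foldl step t w1 by rewrite foldl_step // rep_rep.
by rewrite stepK // catA; apply: (weq_cat (letter_labelK l er)).
Qed.

Lemma label_tree d : weq (edge_word d) [::] -> label d = [::].
Proof. by rewrite /label; case: pickP => // j /eqP <- /e_nontree. Qed.

Lemma path_label_rep t : rep t = t -> path_label [::] t = [::].
Proof.
elim/last_ind: t => // s l IH e1; have es := rep_prefix e1.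
rewrite -cats1 path_label_cat IH //= foldl_step ?rep_nil // es cats0.
by rewrite /letter_label label_tree ?if_same //; exact: tree_edge.
Qed.

Lemma label_e j : label (e j) = [:: (j, false)].
Proof.
rewrite /label; case: pickP => [i /eqP/e_inj -> //|/(_ j)]; by rewrite eqxx.
Qed.

Lemma path_label_edge j : weq (path_label [::] (edge_word (e j))) [:: (j, false)].
Proof.
have er := e_rep j; rewrite /edge_word path_label_cat path_label_rep //=.
rewrite foldl_step ?rep_nil //= er /letter_label /letter_edge /= -surjective_pairing label_e.
set s := step _ _; have es : rep s = s by exact: rep_step.
(* The way back along [word_inv s] has trivial label: so has the loop [s ++ word_inv s], and its
   first half runs in the tree. *)
have := path_label_weq (weq_catVr s) rep_nil.
rewrite path_label_cat path_label_rep // foldl_step ?rep_nil // es /= => e1.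
by exact: (@weq_cat _ [:: (j, false)] _ _ [::] (weq_refl _) e1).
Qed.

Lemma foldl_step_spanned w : H w -> foldl step [::] w = [::].
Proof. by move=> h; rewrite foldl_step ?rep_nil // rep_spanned. Qed.

Lemma path_label_subst g : weq (path_label [::] (subst b g)) g.
Proof.
elim: g => // l g IH; rewrite subst_cons path_label_cat.
have gen : H (if l.2 then word_inv (b l.1) else b l.1).
  by case: l.2; [apply: spanned_inv|]; exact: edge_word_spanned.
rewrite foldl_step_spanned // -[l :: g]cat1s; apply: weq_cat => //.
have e1 := path_label_edge l.1; case: l {IH gen} e1 => j [] //= e1.
have := path_label_weq (weq_catVr (b j)) rep_nil.
rewrite path_label_cat foldl_step_spanned; last exact: edge_word_spanned.
move=> e2; set w := path_label _ (word_inv _) in e2 *.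
have : weq ([:: (j, false)] ++ w) [::].
  by apply: eq_trans e2; apply: weq_cat.
move=> /(weq_cat (weq_refl [:: (j, true)])) h.
exact: eq_trans (esym (weq_cancel [::] w (j, true))) h.
Qed.

Lemma edge_words_independent : independent b.
Proof.
by move=> g eg; rewrite /weq -(path_label_subst g); exact: path_label_weq eg rep_nil.
Qed.

(** The path telescopes into the Schreier generators of its edges, the tree detours between
    consecutive edges cancelling. *)
Lemma path_spanned t w : rep t = t ->
  (forall w1 l w2, w = w1 ++ l :: w2 ->
     weq (edge_word (letter_edge (foldl step t w1) l)) [::] \/
     exists j, letter_edge (foldl step t w1) l = e j) ->
  spanned b (t ++ w ++ word_inv (foldl step t w)).
Proof.
elim: w t => [|l w IH] t et hw.
  exact: spanned_weq (weq_catVr t) (spanned_nil _).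
have h1 : spanned b (t ++ l :: word_inv (step t l)).
  apply: spanned_weq (weq_letter_edge l et) _.
  have g : spanned b (edge_word (letter_edge t l)).
    have [h|[j ->]] := hw [::] l w erefl; first exact: spanned_weq h (spanned_nil _).
    exact: (@spanned_gen _ _ b).
  by case: l.2 => //; exact: spanned_inv.
have h2 : spanned b (step t l ++ w ++ word_inv (foldl step (step t l) w)).
  by apply: IH; [exact: rep_step|move=> w1 l' w2 ew; apply: (hw (l :: w1) l' w2); rewrite ew].
apply: spanned_weq (spanned_cat h1 h2).
by apply/funext => f; rewrite !magnus_cat !magnus_cons magnus_invK.
Qed.

End Labels.

Fixpoint path_edges t w : seq (word n * 'I_n) :=
  if w is l :: w' then letter_edge t l :: path_edges (step t l) w' else [::].

Lemma mem_path_edges t w w1 l w2 : w = w1 ++ l :: w2 ->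
  letter_edge (foldl step t w1) l \in path_edges t w.
Proof.
elim: w1 t w => [|l' w1 IH] t w ->; rewrite /= inE ?eqxx //.
by apply/orP; right; apply: IH.
Qed.

Lemma path_edges_rep t w d : rep t = t -> d \in path_edges t w -> rep d.1 = d.1.
Proof.
elim: w t => //= l w IH t et; rewrite inE => /orP[/eqP ->|/IH]; last by apply; exact: rep_step.
by rewrite /letter_edge /=; case: ifP => _ //; exact: rep_step.
Qed.

Theorem nielsen_schreier : exists k (b : 'I_k -> word n),
  [/\ independent b, forall i, spanned b (a i) & forall j, spanned a (b j)].
Proof.
(* The nontrivial edges crossed by the given generators. They suffice to rewrite these generators,
   and their edge words lie in the subgroup. *)
pose E := [seq d <- undup (flatten [seq path_edges [::] (a i) | i <- enum 'I_r]) |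
            `[< ~ weq (edge_word d) [::] >]].
pose e := tnth (in_tuple E).
have e_inj : injective e.
  by apply/tuple_uniqP; rewrite /= filter_uniq // undup_uniq.
have eE j : e j \in E by exact: mem_tnth.
have e_nontree j : ~ weq (edge_word (e j)) [::].
  by have := eE j; rewrite mem_filter => /andP[/asboolP].
have e_rep j : rep (e j).1 = (e j).1.
  have := eE j; rewrite mem_filter mem_undup => /andP[_ /flatten_mapP[i _]].
  exact/path_edges_rep/rep_nil.
exists (size E), (fun j => edge_word (e j)); split.
- exact: edge_words_independent.
- move=> i; have ga : H (a i) by exact: spanned_gen.
  have := @path_spanned _ e [::] (a i) rep_nil.
  rewrite foldl_step_spanned // cats0; apply=> w1 l w2 ew; have := mem_path_edges [::] ew.
  set d := letter_edge _ _ => dE; case: (pselect (weq (edge_word d) [::])) => h; [by left|right].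
  have /tnthP[j ej] : d \in in_tuple E.
    rewrite mem_filter; apply/andP; split; first exact/asboolP.
    by rewrite mem_undup; apply/flatten_mapP; exists i; rewrite ?mem_enum.
  by exists j.
- by move=> j; exact: edge_word_spanned.
Qed.

End NielsenSchreier.

(** * Ranks of the iterated images and the Hopf property *)

Section RankAndKernels.
Variable n : nat.

Lemma independent_inj k (b : 'I_k -> word n) g g' : independent b ->
  weq (subst b g) (subst b g') -> weq g g'.
Proof.
move=> ind /weq_catV; rewrite -subst_inv -subst_cat => /ind e; exact/weq_catV.
Qed.

(** Rewriting [b] in terms of [a] and back in terms of [b] gives words equal to the basis letters,
    by independence of [b]; on truncated series this is a one-sided inverse, which feeds both the
    rank inequality and the Hopf property. *)
Lemma generators_inverse k k' (a : 'I_k -> word n) (b : 'I_k' -> word n) : independent b ->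
  (forall i, spanned b (a i)) -> (forall j, spanned a (b j)) ->
  exists (A : 'I_k -> word k') (B : 'I_k' -> word k),
    (forall i, weq (a i) (subst b (A i))) /\ (forall c, mx_ext B c *m mx_ext A c = 1%:M)%R.
Proof.
move=> ind /choice[A eA] /choice[B eB]; exists A, B; split=> // c.
rewrite mx_ext_comp -mx_ext_letters; apply: eq_mx_ext => j.
apply: (independent_inj ind); rewrite subst_subst.
have -> : subst b (letters j) = b j by rewrite /subst /= cats0.
by rewrite /weq (eB j); apply: weq_substl => i; rewrite /weq eA.
Qed.

Lemma independent_rank_le k k' (a : 'I_k -> word n) (b : 'I_k' -> word n) : independent b ->
  (forall i, spanned b (a i)) -> (forall j, spanned a (b j)) -> k' <= k.
Proof.
(* In degree at most 1 the matrices have [k'.+1] and [k.+1] monomials as sides. *)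
move=> ind ha hb; have [A [B [_ /(_ 1)/mulmx1_min]]] := generators_inverse ind ha hb.
by rewrite !size_mons /= !muln1.
Qed.

(* Hopf property: a one-sided inverse of a square integer matrix is two-sided. *)
Lemma independent_hopf k (a b : 'I_k -> word n) : independent b ->
  (forall i, spanned b (a i)) -> (forall j, spanned a (b j)) -> independent a.
Proof.
move=> ind ha hb g eg; have [A [B [eA eBA]]] := generators_inverse ind ha hb.
have {}eg : weq (subst A g) [::].
  by apply: ind; rewrite subst_subst /weq -eg; apply: weq_substl => i; rewrite /weq eA.
apply: (@wvec_weq _ _ _ (size g)); first by rewrite addn0.
have e1 : wvec (size g) (subst A g) = wvec (size g) [::] by rewrite /wvec eg.
rewrite -[LHS]mulmx1 -(mulmx1C (eBA _)) mulmxA -wvec_subst e1.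
by rewrite -wvec_subst.
Qed.

Variable b : 'I_n -> word n.
Notation f := (subst b).
Notation X := (fun i j => iter i f (letters j)).

Lemma iter_subst_cat i w w' : iter i f (w ++ w') = iter i f w ++ iter i f w'.
Proof. by elim: i => //= i ->; rewrite subst_cat. Qed.

Lemma iter_subst_inv i w : iter i f (word_inv w) = word_inv (iter i f w).
Proof. by elim: i => //= i ->; rewrite subst_inv. Qed.

Lemma weq_iter_subst i w w' : weq w w' -> weq (iter i f w) (iter i f w').
Proof. by elim: i => //= i IH /IH; exact: weq_subst. Qed.

Lemma iter_subst_spanned i w : spanned (X i) (iter i f w).
Proof. by exists w; rewrite -iter_subst. Qed.

Definition image_basis i k := exists c : 'I_k -> word n,
  [/\ independent c, forall j, spanned c (X i j) & forall l, spanned (X i) (c l)].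

(** The images under [f] of a basis of f^i(F) generate f^(i+1)(F). This bounds the rank, and when
    the ranks agree, these images are independent by the Hopf property. *)
Lemma image_basis_step i k k' : image_basis i k -> image_basis i.+1 k' ->
  k' <= k /\ (k' = k -> forall w, spanned (X i) w -> weq (f w) [::] -> weq w [::]).
Proof.
move=> [c [indc cX Xc]] [c' [indc' cX' Xc']].
pose a l := f (c l).
have aX j : spanned a (X i.+1 j).
  by have [g eg] := cX j; exists g; rewrite -subst_subst /=; exact: weq_subst.
have Xa l : spanned (X i.+1) (a l).
  by have [g eg] := Xc l; exists g; rewrite -subst_subst; exact: weq_subst.
have ac' l : spanned a (c' l) by exact: spanned_trans (Xc' l).
have c'a l : spanned c' (a l) by exact: spanned_trans (Xa l).
split; first exact: independent_rank_le indc' c'a ac'.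
move=> ek; subst k'; have inda := independent_hopf indc' c'a ac'.
move=> w /(spanned_trans cX)[g eg] ew.
have /inda e : weq (subst a g) [::].
  by rewrite -subst_subst /weq -ew; apply: weq_subst; rewrite /weq eg.
by rewrite /weq eg; exact: (weq_subst c e).
Qed.

Lemma injective_stage : exists2 i, i <= n &
  forall w, spanned (X i) w -> weq (f w) [::] -> weq w [::].
Proof.
have ex i : exists k, image_basis i k.
  by have [k [c [h1 h2 h3]]] := nielsen_schreier (X i); exists k, c.
have [s hs] := choice ex; apply: contrapT => no.
(* Failure of injectivity at the stages 0, ..., n would make the rank drop [n.+1] times, starting
   from at most [n]. *)
have dec i : i <= n.+1 -> s i + i <= s 0.
  elim: i => [|i IH] hi; first by rewrite addn0.
  have [le1 eq1] := image_basis_step (hs i) (hs i.+1).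
  apply: leq_trans (IH (ltnW hi)); rewrite addnS -addSn leq_add2r ltn_neqAle le1 andbT.
  apply/eqP => e; apply: no; exists i => //; exact: eq1.
have : s 0 <= n.
  have [c [h1 h2 h3]] := hs 0; exact: independent_rank_le h1 h2 h3.
by have := dec n.+1 (leqnn _); lia.
Qed.

Lemma kernel_stable q w : weq (iter q f (iter n f w)) [::] -> weq (iter n f w) [::].
Proof.
have [i hi inj] := injective_stage.
elim: q => // q IH e; apply: IH; apply: inj; last exact: e.
(* As [i <= n], the argument of the outermost [f] lies in f^i(F), where [f] is injective. *)
have -> : iter q f (iter n f w) = iter i f (iter (q + (n - i)) f w).
  by rewrite -!iterD; congr (iter _ _ _); lia.
exact: iter_subst_spanned.
Qed.

Theorem eventually_equal q w w' : weq (iter q f w) (iter q f w') ->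
  weq (iter n f w) (iter n f w').
Proof.
move=> /(weq_iter_subst n) /weq_catV; rewrite -!iterD addnC !iterD.
rewrite -!iter_subst_inv -!iter_subst_cat => /kernel_stable e.
by apply/weq_catV; rewrite -iter_subst_inv -iter_subst_cat.
Qed.

End RankAndKernels.

(** * The linear orbit problem *)

Section Spectra.
Local Open Scope ring_scope.

Lemma char_poly_similar (R : fieldType) n (P A D : 'M[R]_n) : P \in unitmx ->
  P *m A = D *m P -> char_poly A = char_poly D.
Proof.
move=> uP e; pose Q := map_mx (@polyC R) P.
have uQ : \det Q != 0 by rewrite det_map_mx polyC_eq0 -unitfE -unitmxE.
apply: (mulfI uQ); rewrite [RHS]mulrC /char_poly -!det_mulmx; congr (\det _).
rewrite /char_poly_mx mulmxBl mulmxBr; congr (_ - _); last by rewrite /Q -!map_mxM e.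
by rewrite mul_mx_scalar mul_scalar_mx.
Qed.

Lemma trig_mx_mul (R : pzSemiRingType) n (A B : 'M[R]_n) : is_trig_mx A -> is_trig_mx B ->
  is_trig_mx (A *m B) /\ forall i, (A *m B) i i = A i i * B i i.
Proof.
move=> /is_trig_mxP tA /is_trig_mxP tB; split.
  apply/is_trig_mxP => i j ij; rewrite mxE big1 // => k _.
  have [ik|ki] := ltnP i k; first by rewrite tA ?mul0r.
  by rewrite tB ?mulr0 // (leq_ltn_trans ki).
move=> i; rewrite mxE (bigD1 i) //= big1 ?addr0 // => k.
rewrite neq_ltn => /orP[ki|ik]; first by rewrite tB ?mulr0.
by rewrite tA ?mul0r.
Qed.

(** A triangular form of [A] supplies one list of eigenvalues with multiplicities that serves all
    powers simultaneously. *)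
Lemma spectrum_exists n (A : 'M[algC]_n) :
  exists s : 'I_n -> algC, forall j, char_poly (A ^+ j) = \prod_(l < n) ('X - (s l ^+ j)%:P).
Proof.
case: n A => [|n] A.
  by exists (fun _ => 0) => j; rewrite big_ord0 /char_poly det_mx00.
have [P uP trP] := Schur A (ltn0Sn n).
have {}uP : P \in unitmx by exact: unitarymx_unit.
pose D := P *m A *m invmx P.
have tD : is_trig_mx D by move: trP; rewrite /similar_to conjumx.
have eD : P *m A = D *m P by rewrite /D mulmxKV.
have eDj j : P *m A ^+ j = D ^+ j *m P.
  elim: j => [|j IH]; first by rewrite !expr0 mulmx1 mul1mx.
  by rewrite !exprSr -!mulmxE mulmxA IH -mulmxA eD mulmxA.
exists (fun l => D l l) => j; rewrite (char_poly_similar uP (eDj j)).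
have [tDj dDj] : is_trig_mx (D ^+ j) /\ forall l, (D ^+ j) l l = D l l ^+ j.
  elim: j => [|j [IH1 IH2]].
    rewrite expr0; split; first exact: scalar_mx_is_trig.
    by move=> l; rewrite mxE eqxx.
  rewrite exprSr; have [h1 h2] := trig_mx_mul IH1 tD; split=> // l.
  by rewrite h2 IH2 exprSr.
by rewrite char_poly_trig //; apply: eq_bigr => l _; rewrite dDj.
Qed.

(** Each factor X - z with |z| <= 2 multiplies the bound on coefficients by at most 1 + 2. *)
Lemma coef_prod_bound n (z : 'I_n -> algC) : (forall l, `|z l| <= 2) ->
  forall i, `|(\prod_(l < n) ('X - (z l)%:P))`_i| <= (3 ^ n)%:R.
Proof.
elim: n z => [|n IH] z hz i.
  by rewrite big_ord0 expn0 coef1; case: (i == 0)%N; rewrite ?normr1 ?normr0 ?ler01.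
rewrite big_ord_recr /= mulrBr coefB coefMX coefMC.
set p := \prod_(l < n) _.
have hp k : `|p`_k| <= (3 ^ n)%:R by apply: IH => l; exact: hz.
have -> : (3 ^ n.+1)%:R = (3 ^ n)%:R + (3 ^ n)%:R * 2 :> algC by rewrite expnS natrM; ring.
apply: le_trans (ler_normB _ _) _; apply: lerD.
  by case: i => [|i] //=; rewrite normr0 ler0n.
by rewrite normrM; apply: ler_pM => //; exact: hz.
Qed.

(** The number of vectors of [n.+1] integers of absolute value at most 3^n. *)
Definition kron_bound n := ((2 * 3 ^ n).+1 ^ n.+1)%N.

(* Kronecker's theorem, effective: the polynomials with roots s_l^j, for j up to
   kron_bound n, have integer coefficients of absolute value at most 3^n, so two
   of them coincide. *)
Lemma kronecker n (s : 'I_n -> algC) k e :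
  (forall j, \prod_(l < n) ('X - (s l ^+ j)%:P) \is a polyOver Num.int) ->
  (forall l, `|s l| ^+ k <= (2 ^ e)%:R) -> (0 < e)%N -> (kron_bound n * e <= k)%N ->
  exists M, [/\ (0 < M)%N, (M <= kron_bound n ^ n`!)%N & forall l, s l = 0 \/ s l ^+ M = 1].
Proof.
set J := kron_bound n => sint sk e0 hk; pose f j := \prod_(l < n) ('X - (s l ^+ j)%:P).
(* If |s_l|^j > 2 for some j <= J, then |s_l|^J > 2, and k >= J e would give |s_l|^k > 2^e. *)
have small l j : (j <= J)%N -> `|s l ^+ j| <= 2.
  move=> jJ; rewrite normrX; apply: contrapT => /negP.
  rewrite -real_ltNge ?rpredX ?normr_real ?realn // => big.
  have s1 : 1 <= `|s l|.
    rewrite real_leNgt ?normr_real ?real1 //; apply/negP => /ltW s1.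
    have := lt_le_trans big (exprn_ile1 j (normr_ge0 _) s1).
    by rewrite ltrn1.
  have bigJ : 2 < `|s l| ^+ J.
    by apply: lt_le_trans big _; apply: ler_weXn2l.
  have := le_trans (ler_weXn2l s1 hk) (sk l).
  rewrite exprM natrX => le2.
  have lt2 : 2 ^+ e < `|s l| ^+ J ^+ e by rewrite ltrXn2r // -lt0n.
  by have := lt_le_trans lt2 le2; rewrite ltxx.
have fint j : f j \is a polyOver Num.int by exact: sint.
have fbound (j : 'I_J.+1) i : `|(f j)`_i| <= (3 ^ n)%:R.
  by apply: coef_prod_bound => l; apply: small; rewrite -ltnS ltn_ord.
have fsize j : size (f j) = n.+1 by rewrite size_prod_XsubC /index_enum -enumT size_enum_ord.
pose c (j : 'I_J.+1) : {ffun 'I_n.+1 -> 'I_(2 * 3 ^ n).+1} :=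
  [ffun i : 'I_n.+1 => inord (absz (Num.floor (f j)`_i + (3 ^ n)%N%:Z)%R)].
have cE (j : 'I_J.+1) (i : 'I_n.+1) : (f j)`_i = (Posz (c j i) - Posz (3 ^ n)%N)%:~R.
  have /floorK fi : (f j)`_i \is a Num.int by exact: polyOverP.
  have hb := fbound j i; rewrite -fi -[(3 ^ n)%:R]/((Posz (3 ^ n))%:~R) in hb *.
  rewrite -intr_norm ler_int in hb.
  rewrite ffunE inordK; last by lia.
  congr (_%:~R); lia.
have [j1 [j2 [ne ec]]] : exists j1 j2 : 'I_J.+1, j1 != j2 /\ c j1 = c j2.
  apply: contrapT => no; have inj : injective c.
    move=> j1 j2 e12; apply/eqP; apply: contrapT => /negP ne; apply: no.
    by exists j1, j2.
  by have := leq_card c inj; rewrite card_ffun !card_ord ltnn.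
wlog lt12 : j1 j2 ne ec / (j1 < j2)%N.
  move=> H; move: (ne); rewrite neq_ltn => /orP[lt|lt]; first exact: (H j1 j2).
  by apply: (H j2 j1) => //; rewrite eq_sym.
have ef : f j2 = f j1.
  apply/polyP => i; have [hi|hi] := ltnP i n.+1.
    by rewrite (cE j2 (Ordinal hi)) (cE j1 (Ordinal hi)) ec.
  by rewrite !nth_default ?fsize.
(* Equal polynomials have the same multiset of roots, so the j2-th powers are a permutation of the
   j1-th powers. *)
have [p hp] : exists p : 'S_n, forall l, s l ^+ j2 = s (p l) ^+ j1.
  pose t j := [tuple s l ^+ j | l < n].
  have eft j : \prod_(x <- t j) ('X - x%:P) = f j.
    by rewrite big_tuple; apply: eq_bigr => l _; rewrite tnth_mktuple.
  have : perm_eq (t j2) (t j1) by apply: prod_XsubC_eq; rewrite !eft.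
  move=> /tuple_permP[p ep]; exists p => l.
  have := congr1 (fun u => nth 0 u l) ep.
  by rewrite -!tnth_nth !tnth_mktuple.
(* Iterating the relation along [p] raises both exponents to the power r; at r = n! the permutation
   disappears and each s_l satisfies a relation with itself. *)
have hpr r l : s l ^+ (j2 ^ r) = s ((p ^+ r)%g l) ^+ (j1 ^ r).
  elim: r => [|r IH]; first by rewrite !expn0 expg0 perm1.
  by rewrite expnSr exprM IH -exprM mulnC exprM hp -exprM -expnS expgSr permM.
have ep1 : (p ^+ n`! = 1)%g.
  by rewrite -card_Sn -cardsT; apply: expg_cardG; rewrite in_setT.
have lt_pow : (j1 ^ n`! < j2 ^ n`!)%N by rewrite ltn_exp2r // fact_gt0.
exists (j2 ^ n`! - j1 ^ n`!)%N; split.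
- by rewrite subn_gt0.
- apply: leq_trans (leq_subr _ _) _; rewrite leq_exp2r ?fact_gt0 //.
  by rewrite -ltnS ltn_ord.
move=> l; have := hpr n`! l; rewrite ep1 perm1 => e1.
have [->|nz] := eqVneq (s l) 0; [by left|right].
have nz1 : s l ^+ (j1 ^ n`!) != 0 by rewrite expf_neq0.
by apply: (mulIf nz1); rewrite -exprD mul1r subnK // ltnW.
Qed.

End Spectra.

(** * Bounds for determinants, linear systems and eigenvalues *)

Section CyclicSpaces.
Local Open Scope ring_scope.

Lemma norm_det_le (R : numDomainType) n (A : 'M[R]_n) (B : R) :
  (forall i j, `|A i j| <= B) -> `|\det A| <= n`!%:R * B ^+ n.
Proof.
move=> hA; rewrite /determinant; apply: le_trans (ler_norm_sum _ _ _) _.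
have -> : n`!%:R * B ^+ n = \sum_(s : 'S_n) B ^+ n.
  by rewrite sumr_const card_Sn mulr_natl.
apply: ler_sum => s _; rewrite normrM normr_sign mul1r normr_prod.
have -> : B ^+ n = \prod_(i < n) B by rewrite prodr_const card_ord.
by apply: ler_prod => i _; rewrite normr_ge0 /= hA.
Qed.

Lemma norm_adj_le (R : numDomainType) n (A : 'M[R]_n) (B : R) : 1 <= B ->
  (forall i j, `|A i j| <= B) -> forall i j, `|(\adj A) i j| <= n`!%:R * B ^+ n.
Proof.
case: n A => [|n] A B1 hA i j; first by case: i.
rewrite mxE /cofactor normrM normrX normrN1 expr1n mul1r.
have h : `|\det (row' j (col' i A))| <= n`!%:R * B ^+ n.
  by apply: norm_det_le => a b; rewrite !mxE.
apply: le_trans h _; apply: ler_pM; rewrite ?ler0n ?exprn_ge0 ?(le_trans ler01) //.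
  by rewrite ler_nat leq_fact.
by rewrite ler_weXn2l.
Qed.

(** Select [d] independent columns of [K]: Cramer's rule divides an integer matrix by a nonzero
    integer determinant, whose absolute value is at least 1. Thus the rational matrix [R] is bounded
    through [K] and [Y] alone. *)
Lemma cramer_bound d N (K Y : 'M[int]_(d, N)) (R : 'M[rat]_d) (B : nat) :
  R *m map_mx intr K = map_mx intr Y -> row_free (map_mx intr K : 'M[rat]_(d, N)) ->
  (forall i j, `|K i j| <= B%:R) -> (forall i j, `|Y i j| <= B%:R) -> (0 < B)%N ->
  forall i j, `|R i j| <= (d * (B * (d`! * B ^ d)))%:R.
Proof.
move=> eR freeK hK hY B0 i j.
have fullK : row_full (map_mx intr K : 'M[rat]_(d, N))^T by rewrite /row_full mxrank_tr.
pose f := fullrankfun fullK.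
pose Ks := \matrix_(i, j) K i (f j); pose Ys := \matrix_(i < d, j < d) Y i (f j).
have eRs : R *m map_mx intr Ks = map_mx intr Ys.
  apply/matrixP => a b; have := congr1 (fun A : 'M_(_, _) => A a (f b)) eR; rewrite !mxE => <-.
  by apply: eq_bigr => l _; rewrite !mxE.
have uKs : \det (map_mx intr Ks : 'M[rat]_d) != 0.
  have := fullrowsub_unit fullK; rewrite unitmxE unitfE -det_tr.
  suff -> : (rowsub f (map_mx intr K)^T)^T = map_mx intr Ks :> 'M[rat]_d by [].
  by apply/matrixP => a b; rewrite !mxE.
have eR2 : \det (map_mx intr Ks) *: R = map_mx intr (Ys *m \adj Ks).
  by rewrite map_mxM map_mx_adj -eRs -mulmxA mul_mx_adj mul_mx_scalar.
have detge : 1 <= `|\det (map_mx intr Ks : 'M[rat]_d)|.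
  move: uKs; rewrite det_map_mx intr_eq0 -intr_norm -[1]/(1%:~R) ler_int.
  by rewrite -normr_gt0; lia.
have le1 : `|R i j| <= `|(\det (map_mx intr Ks) *: R) i j|.
  by rewrite mxE normrM ler_peMl.
apply: le_trans le1 _; rewrite eR2 mxE -intr_norm -[(_)%:R]/((Posz _)%:~R) ler_int -natz.
rewrite mxE; apply: le_trans (ler_norm_sum _ _ _) _.
rewrite natrM -[X in X%:R * _]card_ord mulr_natl -sumr_const; apply: ler_sum => l _.
rewrite normrM natrM; apply: ler_pM => //; first by rewrite mxE; exact: hY.
by rewrite natrM natrX; apply: norm_adj_le => [|a b]; rewrite ?ler1n // mxE.
Qed.

(** Compare the sums of absolute values of the entries of [v] and of [v *m A]. *)
Lemma eigen_bound d (A : 'M[algC]_d) (c : nat) (v : 'rV_d) (z : algC) : (forall i j, `|A i j| <= c%:R) ->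
  v *m A = z *: v -> v != 0 -> `|z| <= (d * c)%:R.
Proof.
move=> hA ev nz.
have [i0 hi0] : exists i0, v 0 i0 != 0.
  apply/existsP; apply: contraNT nz => /existsPn h; apply/eqP/rowP => i.
  by rewrite mxE; have := h i; rewrite negbK => /eqP.
have S0 : 0 < \sum_j `|v 0 j|.
  rewrite (bigD1 i0) //=; apply: ltr_wpDr; last by rewrite normr_gt0.
  by apply: sumr_ge0.
rewrite -(ler_pM2r S0) mulr_sumr.
have -> : \sum_j `|z| * `|v 0 j| = \sum_j `|(v *m A) 0 j|.
  by apply: eq_bigr => j _; rewrite ev mxE normrM.
have -> : (d * c)%:R * \sum_j `|v 0 j| = \sum_(j < d) \sum_i `|v 0 i| * c%:R.
  by rewrite sumr_const card_ord -mulr_suml -[RHS]mulr_natl natrM; ring.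
apply: ler_sum => j _; rewrite mxE; apply: le_trans (ler_norm_sum _ _ _) _.
by apply: ler_sum => i _; rewrite normrM; apply: ler_pM.
Qed.
End CyclicSpaces.

(** * The cyclic space spanned by an orbit *)

Section CyclicOrbit.
Local Open Scope ring_scope.
Variables (N : nat) (T : 'M[int]_N).

Definition krylov d (x : 'rV[int]_N) : 'M[int]_(d, N) := \matrix_(i < d) (x *m T ^+ i).

Local Notation ratmx := (map_mx (intr : int -> rat)).

Lemma krylov_dim x : exists d, [/\ (d <= N)%N, row_free (ratmx (krylov d x)) &
  (ratmx (x *m T ^+ d) <= ratmx (krylov d x))%MS].
Proof.
have P0 : exists d, row_free (ratmx (krylov d x)).
  by exists 0%N; rewrite /row_free -leqn0 rank_leq_row.
have Pub d : row_free (ratmx (krylov d x)) -> (d <= N)%N.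
  by move=> /eqP <-; exact: rank_leq_col.
case: (ex_maxnP P0 Pub) => d freed maxd; exists d; split; rewrite ?Pub //.
apply: contrapT => /negP nsub.
suff : row_free (ratmx (krylov d.+1 x)) by move=> /maxd; rewrite ltnn.
apply: inj_row_free => v; rewrite mulmx_sum_row big_ord_recr /=.
have rowE e i : row i (ratmx (krylov e x)) = ratmx (x *m T ^+ i).
  by rewrite -map_row rowK.
rewrite rowE /=; under eq_bigr => i _ do rewrite rowE /= -rowE.
pose v' := \row_(i < d) v 0 (widen_ord (leqnSn d) i).
have -> : \sum_(i < d) v 0 (widen_ord (leqnSn d) i) *: row i (ratmx (krylov d x)) =
    v' *m ratmx (krylov d x).
  by rewrite mulmx_sum_row; apply: eq_bigr => i _; rewrite mxE.
have [v0|vn0] := eqVneq (v 0 ord_max) 0.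
  rewrite v0 scale0r addr0 => e; have v'0 : v' = 0.
    by apply: (row_free_inj freed); rewrite /= e mul0mx.
  apply/rowP => i; rewrite mxE; case: (unliftP ord_max i) => [j ->|-> //].
  have /rowP/(_ j) := v'0; rewrite !mxE => <-; congr (v _ _); apply: val_inj => /=.
  by rewrite /bump leqNgt ltn_ord.
move=> /eqP; rewrite addr_eq0 => /eqP e; case/negP: nsub.
rewrite -(eqmx_scale _ vn0) -[_ *: _]opprK -e eqmx_opp; exact: submxMl.
Qed.

Definition row_norm (v : 'rV[int]_N) : int := \sum_j `|v 0 j|.

Implicit Types (u v x y : 'rV[int]_N).

Lemma row_norm_entry v j : `|v 0 j| <= row_norm v.
Proof. by rewrite /row_norm (bigD1 j) //= lerDl sumr_ge0. Qed.

Lemma row_norm_ge0 v : 0 <= row_norm v.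
Proof. by apply: sumr_ge0. Qed.

Lemma row_normD u v : row_norm (u + v) <= row_norm u + row_norm v.
Proof.
by rewrite /row_norm -big_split; apply: ler_sum => j _; rewrite mxE; exact: ler_normD.
Qed.

Lemma row_normN u : row_norm (- u) = row_norm u.
Proof. by apply: eq_bigr => j _; rewrite mxE normrN. Qed.

Variable a : nat.
Hypothesis a_gt0 : (0 < a)%N.
Hypothesis T_bound : forall v, row_norm (v *m T) <= a%:R * row_norm v.

Lemma row_norm_iter v i : row_norm (v *m T ^+ i) <= (a ^ i)%:R * row_norm v.
Proof.
elim: i => [|i IH]; first by rewrite expr0 mulmx1 expn0 mul1r.
rewrite exprSr mulmxA; apply: le_trans (T_bound _) _.
by rewrite expnS natrM -mulrA ler_wpM2l ?ler0n.
Qed.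

(** [B] bounds the entries of x T^i and y T^i for i <= N; the Cramer bound built from it, times the
    dimension, bounds the k-th powers of the eigenvalues. The successor makes the exponent [e] of
    [kronecker] positive. *)
Definition spectral_bound X := let B := (a ^ N * X)%N in
  (N * (N * (B * (N`! * B ^ N)))).+1%N.

(** [C] is only rational, but its eigenvalues will be eigenvalues of an integer matrix: coefficients
    that are both rational and algebraic integers are integers. *)
Lemma char_poly_map_int d (C : 'M[rat]_d) (s : 'I_d -> algC) :
  (forall j, char_poly (map_mx ratr C ^+ j) = \prod_(l < d) ('X - (s l ^+ j)%:P)) ->
  (forall l, s l \in Aint) -> forall j, \prod_(l < d) ('X - (s l ^+ j)%:P) \is a polyOver Num.int.
Proof.
move=> hs sA j; apply/polyOverP => i; apply: Cint_rat_Aint.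
  by rewrite -hs -rmorphXn /= -map_char_poly coef_map; exact: Crat_rat.
have : \prod_(l < d) ('X - (s l ^+ j)%:P) \is a polyOver Aint.
  by apply: rpred_prod => l _; rewrite rpredB ?polyOverX // polyOverC rpredX.
by move/polyOverP.
Qed.

Lemma intertwine_exp (R : pzRingType) m n (A : 'M[R]_m) (B : 'M[R]_n) (K : 'M[R]_(m, n)) j :
  A *m K = K *m B -> A ^+ j *m K = K *m B ^+ j.
Proof.
move=> e; elim: j => [|j IH]; first by rewrite !expr0 mul1mx mulmx1.
by rewrite !exprSr -!mulmxE -mulmxA e !mulmxA IH.
Qed.

Lemma kron_bound_leq d n : (d <= n)%N -> (kron_bound d <= kron_bound n)%N.
Proof.
move=> dn; rewrite /kron_bound; have h : (2 * 3 ^ d <= 2 * 3 ^ n)%N.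
  by rewrite leq_mul2l /= leq_exp2l.
apply: (@leq_trans ((2 * 3 ^ n).+1 ^ d.+1)); first by rewrite leq_exp2r.
exact: leq_pexp2l.
Qed.

Lemma kron_bound_gt0 n : (0 < kron_bound n)%N.
Proof. by rewrite expn_gt0. Qed.

Lemma orbit_spectrum x y X k : (0 < X)%N -> row_norm x <= X%:R -> row_norm y <= X%:R ->
  x *m T ^+ k = y -> (kron_bound N * spectral_bound X <= k)%N ->
  exists M, [/\ (0 < M)%N, (M <= kron_bound N ^ N`!)%N & x *m (T ^+ N * (T ^+ M - 1) ^+ N) = 0].
Proof.
move=> X0 hx hy exy hk.
have [d [dN freed subd]] := krylov_dim x.
pose K := ratmx (krylov d x); pose Tq := ratmx T.
have rowKr e z i : row i (ratmx (krylov e z)) = ratmx (z *m T ^+ i).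
  by rewrite -map_row rowK.
have KT : (K *m Tq <= K)%MS.
  apply/row_subP => i; rewrite row_mul rowKr -map_mxM -mulmxA mulmxE -exprSr.
  have := ltn_ord i; rewrite -ltnS ltnS leq_eqVlt => /orP[/eqP -> //|hi].
  by rewrite -(rowKr d x (Ordinal hi)) row_sub.
(* K T = C K, and the rows of C^k are the coordinates of the y T^i in the Krylov
   basis of x, so that Cramer's rule bounds them independently of k. *)
pose C := K *m Tq *m pinvmx K.
have CK1 : C *m K = K *m Tq by rewrite /C mulmxKpV.
have CK j := intertwine_exp j CK1.
have Tqj j : Tq ^+ j = ratmx (T ^+ j) by rewrite rmorphXn.
pose B := (a ^ N * X)%N.
have B0 : (0 < B)%N by rewrite muln_gt0 expn_gt0 a_gt0.
have hiter v i : (i <= N)%N -> row_norm v <= X%:R -> row_norm (v *m T ^+ i) <= B%:R.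
  move=> iN hv; apply: le_trans (row_norm_iter v i) _; rewrite natrM.
  apply: ler_pM => //; rewrite ?ler0n ?row_norm_ge0 // ler_nat.
  exact: leq_pexp2l.
pose Y : 'M[int]_(d, N) := krylov d y.
have eY : C ^+ k *m K = ratmx Y.
  rewrite CK Tqj; apply/row_matrixP => i; rewrite row_mul !rowKr -map_mxM -exy.
  by rewrite -!mulmxA !mulmxE -!exprD addnC.
have Ck i j : `|(C ^+ k) i j| <= (d * (B * (d`! * B ^ d)))%:R.
  have kb z (i' : 'I_d) j' : row_norm z <= X%:R -> `|krylov d z i' j'| <= B%:R.
    move=> hz; rewrite mxE; apply: le_trans (row_norm_entry _ _) _; apply: hiter => //.
    by apply: ltnW; apply: leq_trans dN.
  by apply: (cramer_bound eY freed) => // i' j'; exact: kb.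
pose Cc : 'M[algC]_d := map_mx ratr C.
have [s hs] := spectrum_exists Cc.
have sE l : exists2 v : 'rV[algC]_d, v *m Cc = s l *: v & v != 0.
  apply/eigenvalueP; rewrite eigenvalue_root_char.
  have := hs 1%N; rewrite expr1 => ->; rewrite (bigD1 l) //= rootM expr1.
  by rewrite root_XsubC eqxx.
have sA l : s l \in Aint.
  have [v ev vn0] := sE l.
  pose w : 'rV[algC]_N := v *m map_mx ratr K.
  have wn0 : w != 0.
    have freec : row_free (map_mx ratr K : 'M[algC]_(d, N)) by rewrite row_free_map.
    by rewrite -(mul0mx _ (map_mx ratr K)) (inj_eq (row_free_inj freec)).
  pose Tc : 'M[algC]_N := map_mx intr T.
  have eT : Tc = map_mx ratr Tq.
    by apply/matrixP => i j; rewrite !mxE ratr_int.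
  have : eigenvalue Tc (s l).
    apply/eigenvalueP; exists w => //.
    by rewrite eT -mulmxA -map_mxM -CK1 map_mxM mulmxA ev -scalemxAl.
  rewrite eigenvalue_root_char => rt; apply: root_monic_Aint rt (char_poly_monic _) _.
  rewrite -(map_char_poly (intr : int -> algC)); apply/polyOverP => i.
  by rewrite coef_map /= intr_int.
have sk l : `|s l| ^+ k <= (2 ^ spectral_bound X)%:R.
  have [v ev vn0] := sE l.
  have evk j : v *m Cc ^+ j = s l ^+ j *: v.
    elim: j => [|j IH]; first by rewrite !expr0 mulmx1 scale1r.
    by rewrite exprSr -mulmxE mulmxA IH -scalemxAl ev scalerA -exprSr.
  rewrite -normrX; pose c := (d * (B * (d`! * B ^ d)))%N.
  have Cck i j : `|(Cc ^+ k) i j| <= c%:R.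
    have -> : Cc ^+ k = map_mx ratr (C ^+ k) by rewrite rmorphXn.
    by rewrite mxE -ratr_norm -(ratr_nat algC) ler_rat; exact: Ck.
  apply: le_trans (eigen_bound Cck (evk k) vn0) _; rewrite ler_nat.
  have le1 : (d * c <= spectral_bound X)%N.
    apply: leqW; rewrite leq_mul // /c leq_mul // leq_mul // leq_mul //; first exact: leq_fact.
    exact: leq_pexp2l.
  exact: leq_trans le1 (ltnW (ltn_expl _ (ltnSn 1))).
have hkd : (kron_bound d * spectral_bound X <= k)%N.
  by apply: leq_trans hk; rewrite leq_mul2r kron_bound_leq ?orbT.
have [M [M0 hM sM]] := kronecker (char_poly_map_int hs sA) sk (ltn0Sn _) hkd.
exists M; split=> //.
  apply: leq_trans hM _; apply: leq_trans (leq_pexp2l (kron_bound_gt0 _) (leq_fact dN)).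
  by rewrite leq_exp2r ?fact_gt0 // kron_bound_leq.
suff xd : x *m (T ^+ d * (T ^+ M - 1) ^+ d) = 0.
  have -> : T ^+ N * (T ^+ M - 1) ^+ N =
      T ^+ d * (T ^+ M - 1) ^+ d * (T ^+ (N - d) * (T ^+ M - 1) ^+ (N - d)).
    have com : GRing.comm (T ^+ (N - d)) ((T ^+ M - 1) ^+ d).
      by apply/commrX/commrB; [exact/commrX/commr_sym/commrX|exact: commr1].
    have eN (A : 'M[int]_N) : A ^+ N = A ^+ d * A ^+ (N - d) by rewrite -exprD subnKC.
    rewrite (eN T) (eN (T ^+ M - 1)) -!mulrA; congr (_ * _).
    by rewrite mulrA com -!mulrA.
  have := congr1 (mulmx^~ (T ^+ (N - d) * (T ^+ M - 1) ^+ (N - d))) xd.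
  by rewrite /= mul0mx -mulmxA.
(* The case [d = 0] means [x = 0]; it is split off because evaluating polynomials at [C] requires
   positive dimension. *)
case: d => [|d] in K Y C s Cc hkd hM dN freed subd rowKr KT CK1 CK eY Ck hs sE sA sk sM *.
  have x0 : x = 0.
    apply/rowP => j; have := subd; rewrite expr0 mulmx1 [ratmx (krylov 0 x)]flatmx0.
    by move=> /submx0null/rowP/(_ j); rewrite !mxE => /eqP; rewrite intr_eq0 => /eqP.
  by rewrite x0 mul0mx.
(* Every eigenvalue of [C] is 0 or an M-th root of unity, a root of [g]; the power of [g] absorbs
   the multiplicities, and Cayley-Hamilton applies. *)
pose g : {poly rat} := 'X * ('X^M - 1).
have dvdg : char_poly C %| g ^+ d.+1.
  rewrite -(dvdp_map (ratr : {rmorphism rat -> algC})) map_char_poly /=.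
  have := hs 1%N; rewrite expr1 => ->; rewrite rmorphXn /= -[X in _ ^+ X]card_ord -prodr_const.
  elim/big_ind2: _ => [|p1 p2 q1 q2|l _]; [exact: dvdpp|exact: dvdp_mul|].
  rewrite dvdp_XsubCl /g rmorphM rmorphB /= map_polyX rmorphXn /= map_polyX rmorph1.
  rewrite rootM rootX /root !hornerE subr_eq0.
  by case: (sM l) => ->; rewrite ?eqxx ?orbT.
have C0 : C ^+ d.+1 * (C ^+ M - 1) ^+ d.+1 = 0.
  have [q eq] : exists q, g ^+ d.+1 = q * char_poly C by apply/dvdpP.
  have : horner_mx C (g ^+ d.+1) = 0 by rewrite eq rmorphM /= Cayley_Hamilton mulr0.
  rewrite rmorphXn rmorphM rmorphB /= horner_mx_X rmorphXn /= horner_mx_X rmorph1 exprMn_comm //.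
  by apply: commrB; [exact/commrX/commr_refl|exact: commr1].
have CKM : (C ^+ M - 1) *m K = K *m (Tq ^+ M - 1).
  by rewrite mulmxBl mulmxBr CK mul1mx mulmx1.
have : K *m (Tq ^+ d.+1 * (Tq ^+ M - 1) ^+ d.+1) = 0.
  rewrite -mulmxE mulmxA -CK -mulmxA -(intertwine_exp _ CKM) mulmxA.
  by have := congr1 (mulmx^~ K) C0; rewrite /= mul0mx.
(* The first row of the Krylov matrix is [x] itself. *)
move/(congr1 (row ord0)); rewrite row_mul rowKr expr0 mulmx1 row0.
have -> : Tq ^+ d.+1 * (Tq ^+ M - 1) ^+ d.+1 = ratmx (T ^+ d.+1 * (T ^+ M - 1) ^+ d.+1).
  by rewrite rmorphM !rmorphXn rmorphB rmorphXn rmorph1.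
rewrite -map_mxM => /rowP e; apply/rowP => j.
by have := e j; rewrite !mxE => /eqP; rewrite intr_eq0 => /eqP.
Qed.
End CyclicOrbit.

(** * Long linear orbits end in a periodic vector *)

Section LinearOrbit.

(** In [linear_orbit], the multiple [j] of a nonzero integer vector is the difference of two
    vectors, each of norm at most half of this number. *)
Definition growth_bound N a X := let Mx := kron_bound N ^ N`! in
  ((a ^ Mx).+1 ^ N * (a ^ (N + Mx) * X)).*2.

(** The first summand makes [orbit_spectrum] applicable; the second forces the quotient [j] of
    [k - N] by the period above [growth_bound]. *)
Definition orbit_bound N a X := let Mx := kron_bound N ^ N`! in
  kron_bound N * spectral_bound N a X + (N + Mx * (growth_bound N a X).+2).

Local Open Scope ring_scope.
Variables (N : nat) (T : 'M[int]_N) (a : nat).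
Hypothesis a_gt0 : (0 < a)%N.
Hypothesis T_bound : forall v, row_norm (v *m T) <= a%:R * row_norm v.
Implicit Types (u v x y z : 'rV[int]_N).

Lemma row_norm_gt0 v : v != 0 -> 1 <= row_norm v.
Proof.
move=> vn0; have [j hj] : exists j, v 0 j != 0.
  apply/existsP; apply: contraNT vn0 => /existsPn h; apply/eqP/rowP => i.
  by rewrite mxE; have := h i; rewrite negbK => /eqP.
by apply: le_trans (row_norm_entry v j); move: hj; rewrite -normr_gt0; lia.
Qed.

Lemma row_norm_natZ (j : nat) v : row_norm (j%:R *: v) = j%:R * row_norm v.
Proof.
rewrite /row_norm mulr_sumr; apply: eq_bigr => i _.
by rewrite mxE normrM normr_nat.
Qed.

Lemma unipotent_iter M z j : z *m (T ^+ M - 1) *m (T ^+ M - 1) = 0 ->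
  z *m T ^+ (M * j) = z + j%:R *: (z *m (T ^+ M - 1)).
Proof.
set E := T ^+ M - 1 => zE; have TM : T ^+ M = 1 + E by rewrite addrC subrK.
elim: j => [|j IH]; first by rewrite muln0 expr0 mulmx1 scale0r addr0.
rewrite mulnS addnC exprD -mulmxE mulmxA IH TM mulmxDr mulmx1 mulmxDl -scalemxAl zE scaler0 addr0.
by rewrite -addrA -[in RHS]natr1 scalerDl scale1r.
Qed.

Theorem linear_orbit x y X k : (0 < X)%N -> row_norm x <= X%:R -> row_norm y <= X%:R ->
  x *m T ^+ k = y -> (orbit_bound N a X <= k)%N -> exists2 m, (0 < m)%N & y *m T ^+ m = y.
Proof.
move=> X0 hx hy exy hk; set Mx := (kron_bound N ^ N`!)%N.
have hk1 : (kron_bound N * spectral_bound N a X <= k)%N.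
  by apply: leq_trans hk; exact: leq_addr.
have hk2 : (N + Mx * (growth_bound N a X).+2 <= k)%N.
  by apply: leq_trans hk; exact: leq_addl.
have [M [M0 hM xNM]] := orbit_spectrum a_gt0 T_bound X0 hx hy exy hk1.
exists M => //; set E := T ^+ M - 1 in xNM.
pose r := ((k - N) %% M)%N; pose j := ((k - N) %/ M)%N.
have ek : k = (N + r + M * j)%N.
  by have := divn_eq (k - N) M; rewrite -/r -/j mulnC; lia.
(* After [N] steps the nilpotent part is gone, and the remainder [r] leaves a multiple of [M] to
   travel. *)
pose x2 := x *m T ^+ (N + r).
have x2y : x2 *m T ^+ (M * j) = y by rewrite -exy ek /x2 -mulmxA mulmxE -exprD.
have comTE i l : T ^+ i * E ^+ l = E ^+ l * T ^+ i.
  by apply/commrX/commrB; [exact/commrX/commr_sym/commrX|exact: commr1].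
have x2N : x2 *m E ^+ N = 0.
  rewrite /x2 -mulmxA mulmxE exprD -mulrA comTE mulrA.
  by have := congr1 (mulmx^~ (T ^+ r)) xNM; rewrite /= mul0mx -mulmxA.
have [x2E|x2E] := eqVneq (x2 *m E) 0.
  have x2M : x2 *m T ^+ M = x2.
    by move/eqP: x2E; rewrite mulmxBr mulmx1 subr_eq0 => /eqP.
  by rewrite -x2y -mulmxA mulmxE -exprD addnC exprD -mulmxE mulmxA x2M.
(* With the least exponent [i.+2], the vector [z = x2 E^i] is killed by E^2 but not by E, so it
   moves linearly in [j]. *)
have exi : exists i, x2 *m E ^+ i == 0 by exists N; rewrite x2N.
case: (ex_minnP exi) => [[|[|i]]] /eqP x2i mini.
- by move: x2E; rewrite -[x2]mulmx1 -[1%:M]/(1 : 'M_N) -(expr0 E) x2i mul0mx eqxx.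
- by move: x2E; rewrite -[E]expr1 x2i eqxx.
have iN : (i <= N)%N by have := mini N; rewrite x2N eqxx => /(_ isT); lia.
pose z := x2 *m E ^+ i.
have zE : z *m E != 0.
  rewrite /z -mulmxA mulmxE -exprSr; apply/negP => /mini; by rewrite ltnn.
have zEE : z *m E *m E = 0 by rewrite -x2i /z !exprSr -!mulmxA -mulrA.
have e1 := unipotent_iter j zEE.
have e2 : z *m T ^+ (M * j) = y *m E ^+ i.
  by rewrite -x2y /z -!mulmxA !mulmxE comTE.
have normE v l : row_norm (v *m E ^+ l) <= (((a ^ M).+1 ^ l)%N)%:R * row_norm v.
  elim: l => [|l IH]; first by rewrite expr0 mulmx1 expn0 mul1r.
  rewrite exprSr -mulmxE mulmxA; set w := v *m E ^+ l in IH *.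
  apply: (@le_trans _ _ (((a ^ M).+1)%:R * row_norm w)).
    rewrite mulmxBr mulmx1; apply: le_trans (row_normD _ _) _; rewrite row_normN.
    by rewrite -natr1 mulrDl mul1r lerD2r; exact: row_norm_iter.
  by rewrite expnS natrM -mulrA ler_wpM2l ?ler0n.
have MMx : (M <= Mx)%N by [].
have gb v : row_norm v <= (a ^ (N + Mx) * X)%:R ->
    row_norm (v *m E ^+ i) <= (((a ^ Mx).+1 ^ N * (a ^ (N + Mx) * X))%N)%:R.
  move=> hv; apply: le_trans (normE v i) _; rewrite natrM; apply: ler_pM => //.
    exact: row_norm_ge0.
  rewrite ler_nat; apply: (@leq_trans ((a ^ Mx).+1 ^ i)); last exact: leq_pexp2l.
  by case: (i) => // i'; rewrite leq_exp2r // ltnS leq_pexp2l.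
have hx2 : row_norm x2 <= (a ^ (N + Mx) * X)%:R.
  apply: le_trans (row_norm_iter T_bound _ _) _; rewrite natrM; apply: ler_pM => //.
    exact: row_norm_ge0.
  by rewrite ler_nat leq_pexp2l // leq_add2l ltnW // (leq_trans _ MMx) // ltn_pmod.
have hy2 : row_norm y <= (a ^ (N + Mx) * X)%:R.
  apply: le_trans hy _; rewrite ler_nat leq_pmull // expn_gt0 a_gt0 //.
(* The displacement j (zE) equals y E^i - z, which is bounded independently of [k], while [zE] is a
   nonzero integer vector. *)
have hj : (j <= growth_bound N a X)%N.
  rewrite -(ler_nat int); apply: (@le_trans _ _ (row_norm (j%:R *: (z *m E)))).
    by rewrite row_norm_natZ ler_peMr // row_norm_gt0.
  have -> : j%:R *: (z *m E) = y *m E ^+ i - z by rewrite -e2 e1 addrC addKr.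
  apply: le_trans (row_normD _ _) _; rewrite row_normN /growth_bound -addnn natrD.
  by apply: lerD; apply: gb.
have rM : (r < M)%N by rewrite ltn_pmod.
have le1 : (M * j <= Mx * growth_bound N a X)%N by rewrite leq_mul.
exfalso; move: hk2; rewrite ek !mulnS; lia.
Qed.

End LinearOrbit.

(** * A uniform period *)

Section Congruence3.
Local Open Scope ring_scope.
Variables (N : nat) (P : 'rV[int]_N -> Prop).
Hypothesis P_add : forall u v, P u -> P v -> P (u + v).
Hypothesis P_scale : forall (c : int) u, P u -> P (c *: u).
Implicit Types (S : 'M[int]_N) (z y : 'rV[int]_N).

Definition cong3 S := forall z, P z -> exists2 y, P y & z *m S = z + 3 *: y.

Lemma cong3_stable S z : cong3 S -> P z -> P (z *m S).
Proof. by move=> cS Pz; have [y Py ->] := cS z Pz; apply/P_add => //; exact: P_scale. Qed.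

Lemma cong3_exp S t : cong3 S -> cong3 (S ^+ t).
Proof.
move=> cS; elim: t => [|t IH] z Pz.
  exists (0 *: z); first exact: P_scale.
  by rewrite expr0 mulmx1 scale0r scaler0 addr0.
have [y Py e] := IH z Pz; have [y1 Py1 e1] := cS z Pz; have [y2 Py2 e2] := cS y Py.
exists (y1 + (y + 3 *: y2)); first by do 2?[apply: P_add => //]; exact: P_scale.
by rewrite exprSr -mulmxE mulmxA e mulmxDl e1 -scalemxAl e2 !scalerDr !addrA.
Qed.

(** By iteration z S - z is divisible by every power of 3, and an integer c divisible by 3^|c| is
    0. *)
Lemma divisible_by_powers S : cong3 S ->
  (forall z, P z -> exists2 y, P y & z *m S - z = 3 *: (y *m S - y)) ->
  forall z, P z -> z *m S = z.
Proof.
move=> cS H z Pz.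
have Hk k : exists y, z *m S - z = (3 ^ k)%N%:R *: (y *m S - y) /\ P y.
  elim: k => [|k [y [e Py]]]; first by exists z; rewrite scale1r.
  have [y' Py' e'] := H y Py; exists y'; split=> //.
  by rewrite e e' scalerA expnSr natrM.
apply/eqP; rewrite -subr_eq0; apply/eqP/rowP => i; rewrite [RHS]mxE.
set c := (z *m S - z) 0 i.
have [y [e _]] := Hk `|c|%N.
have ec : c = (3 ^ `|c|)%N%:R * (y *m S - y) 0 i by rewrite {1}/c e mxE.
have lt3 : (`|c| < 3 ^ `|c|)%N by exact: ltn_expl.
apply/eqP/contraT => cn0; move: ec; set q := (y *m S - y) 0 i; set K := (3 ^ _)%N in lt3 *.
rewrite natz => ec; have q0 : q != 0 by apply: contraNneq cn0 => q0; rewrite ec q0 mulr0.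
have : (`|c| = K * `|q|)%N by rewrite {1}ec abszM.
have : (0 < `|q|)%N by rewrite absz_gt0.
by nia.
Qed.

(** Write S = 1 + 3Y. Then S^3 = 1 reads Y = -3(Y^2 + Y^3), which exhibits 3Y as three times the
    displacement of -(Y + Y^2). Squaring 1 + 2Y would yield only Y = -Y^2, without a gain in
    divisibility. *)
Lemma cong3_cube S : cong3 S -> (forall z, P z -> z *m S ^+ 3 = z) ->
  forall z, P z -> z *m S = z.
Proof.
move=> cS h; apply: divisible_by_powers => // z Pz.
have [y Py ez] := cS z Pz; have [y2 Py2 ey] := cS y Py; have [y3 Py3 ey2] := cS y2 Py2.
exists (-1 *: y + -1 *: y2); first by apply: P_add; exact: P_scale.
have := h z Pz; rewrite !exprSr expr0 mul1r -!mulmxE !mulmxA ez.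
rewrite !mulmxDl -!scalemxAl ez !mulmxDl -!scalemxAl ey !mulmxDl -!scalemxAl ey ey2 => e; rewrite ez in e.
apply/rowP => i; have := congr1 (fun A : 'rV_N => A 0 i) e; rewrite !mxE; lra.
Qed.

(** Modulo 3(S - 1), S^t - 1 is t(S - 1); as t is 1 or -1 mod 3, vanishing of S^t - 1 makes S - 1
    divisible by 3 in the required sense. *)
Lemma cong3_coprime S t : ~~ (3 %| t)%N -> cong3 S -> (forall z, P z -> z *m S ^+ t = z) ->
  forall z, P z -> z *m S = z.
Proof.
move=> nt cS h; apply: divisible_by_powers => // z Pz.
have [y Py ez] := cS z Pz; have [y2 Py2 ey] := cS y Py.
have H i : exists2 y', P y' & z *m S ^+ i = z + i%:R *: (3 *: y) + 3 *: (y' *m S - y').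
  elim: i => [|i [y' Py' IH]].
    exists (0 *: z); first exact: P_scale.
    by rewrite expr0 mulmx1 -scalemxAl !scale0r subr0 scaler0 !addr0.
  have PyS := cong3_stable cS Py'.
  exists (i%:R *: y + y' *m S); first by apply: P_add => //; exact: P_scale.
  rewrite exprSr -mulmxE mulmxA IH !mulmxDl -!scalemxAl mulmxBl ez ey -natr1.
  move: (y' *m S *m S) (y' *m S) => w1 w2.
  by apply/rowP => l; rewrite !mxE; ring.
have [y' Py' e] := H t; rewrite h // in e.
have [q et] : exists q : nat, t = (q * 3 + 1)%N \/ t = (q * 3 + 2)%N.
  exists (t %/ 3)%N; have := divn_eq t 3; have := ltn_pmod t (isT : (0 < 3)%N).
  by move: nt; rewrite /dvdn; lia.
have PS := cong3_stable cS Py'.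
case: et => et; rewrite et in e.
  exists (-1 *: y' + - q%:R *: z); first by apply: P_add; exact: P_scale.
  rewrite mulmxDl -!scalemxAl ez; move: (y' *m S) e => w e.
  apply/rowP => i; have := congr1 (fun A : 'rV_N => A 0 i) e; rewrite !mxE natrD natrM; lra.
exists (y' + (q%:R + 1) *: z); first by apply: P_add => //; exact: P_scale.
rewrite mulmxDl -!scalemxAl ez; move: (y' *m S) e => w e.
apply/rowP => i; have := congr1 (fun A : 'rV_N => A 0 i) e; rewrite !mxE natrD natrM; lra.
Qed.

Lemma cong3_finite_order S t : (0 < t)%N -> cong3 S -> (forall z, P z -> z *m S ^+ t = z) ->
  forall z, P z -> z *m S = z.
Proof.
elim/ltn_ind: t S => t IH S t0 cS h.
case: (boolP (3 %| t)%N) => [/dvdnP[q et]|nt]; last exact: cong3_coprime nt cS h.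
have q0 : (0 < q)%N by move: t0; rewrite et; case: q {et}.
apply: (IH q) => //; first by rewrite et; lia.
apply: cong3_cube; first exact: cong3_exp.
by move=> z Pz; rewrite -exprM -et h.
Qed.

End Congruence3.

(** * Periodic vectors of filtered operators *)

Section GradedOperators.
Local Open Scope ring_scope.
Variable N : nat.
Implicit Types (R T : 'M[int]_N) (z y : 'rV[int]_N).

(** On the vectors of period [m], R is invertible, so idempotence of R^M mod 3 improves to R^M = 1
    mod 3, and R^M has finite order there. *)
Lemma periodic_mod3 R Q M m z : (0 < m)%N -> (0 < M)%N -> R ^+ (M + M) - R ^+ M = 3 *: Q ->
  z *m R ^+ m = z -> z *m R ^+ M = z.
Proof.
move=> m0 M0 eQ; pose P y := y *m R ^+ m = y.
have P_add u v : P u -> P v -> P (u + v) by rewrite /P mulmxDl => -> ->.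
have P_scale (c : int) u : P u -> P (c *: u) by rewrite /P -scalemxAl => ->.
have P_R u i : P u -> P (u *m R ^+ i).
  by rewrite /P -mulmxA mulmxE -exprD addnC exprD -mulmxE mulmxA => ->.
have P_iter u i : P u -> u *m R ^+ (m * i) = u.
  move=> Pu; elim: i => [|i IH]; first by rewrite muln0 expr0 mulmx1.
  by rewrite mulnS exprD -mulmxE mulmxA Pu.
apply: (@cong3_finite_order _ P P_add P_scale (R ^+ M) m m0) => [u Pu|u Pu]; last first.
  by rewrite -exprM mulnC P_iter.
pose u0 := u *m R ^+ (m * M - M).
have eu0 : u0 *m R ^+ M = u.
  by rewrite /u0 -mulmxA mulmxE -exprD subnK ?P_iter // leq_pmull.
have e3 : u *m R ^+ M = u + 3 *: (u0 *m Q).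
  by rewrite scalemxAr -eQ mulmxBr exprD -mulmxE mulmxA eu0 addrC subrK.
exists (u0 *m Q) => //.
(* The quotient by 3 must itself be periodic; this holds because integer vectors have no torsion. *)
have : P (3 *: (u0 *m Q)).
  have -> : 3 *: (u0 *m Q) = u *m R ^+ M + -1 *: u by rewrite e3 addrC scaleN1r addKr.
  by apply: P_add; [exact: P_R|exact: P_scale].
rewrite /P -scalemxAl; move: (u0 *m Q *m R ^+ m) (u0 *m Q) => w1 w2 e.
by apply/rowP => i; have := congr1 (fun A : 'rV_N => A 0 i) e; rewrite !mxE; lra.
Qed.

Variable deg : 'I_N -> nat.
Definition graded_part T : 'M[int]_N := \matrix_(i, j) (if deg i == deg j then T i j else 0).
Definition filtered T := forall i j, (deg j < deg i)%N -> T i j = 0.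

Lemma filtered_mul T T' : filtered T -> filtered T' -> filtered (T *m T').
Proof.
move=> fT fT' i j ji; rewrite mxE big1 // => k _.
have [ki|ik] := ltnP (deg k) (deg i); first by rewrite fT ?mul0r.
by rewrite fT' ?mulr0 // (leq_trans ji).
Qed.

Lemma graded_part_mul T T' : filtered T -> filtered T' ->
  graded_part (T *m T') = graded_part T *m graded_part T'.
Proof.
move=> fT fT'; apply/matrixP => i j; rewrite !mxE; case: eqP => [ij|/eqP ij].
  apply: eq_bigr => k _; rewrite !mxE -ij [deg k == _]eq_sym; case: eqP => // /eqP.
  rewrite neq_ltn => /orP[ik|ki]; rewrite ?mulr0 ?mul0r.
    by rewrite fT' ?mulr0 // -ij.
  by rewrite fT ?mul0r.
rewrite big1 // => k _; rewrite !mxE; case: eqP => [<-|]; rewrite ?mul0r //.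
by rewrite (negbTE ij) mulr0.
Qed.

Lemma graded_part_exp T k : filtered T -> filtered (T ^+ k) /\
  graded_part (T ^+ k) = graded_part T ^+ k.
Proof.
move=> fT; elim: k => [|k [IH1 IH2]].
  rewrite !expr0; split=> [i j|]; first by rewrite mxE; case: eqP => // ->; rewrite ltnn.
  by apply/matrixP => i j; rewrite !mxE; case: (i =P j) => [->|]; rewrite ?eqxx // if_same.
rewrite !exprSr; split; first exact: filtered_mul.
by rewrite graded_part_mul // IH2.
Qed.

(** The lowest piece of a periodic vector is fixed by the M-th power of the graded part, so E = T^M
    - 1 raises its lowest degree and is nilpotent on periodic vectors. If z E^2 = 0, then z = z
    T^(Mm) = z + m zE forces zE = 0. *)
Lemma filtered_periodic T Q M m y : filtered T -> (0 < m)%N -> (0 < M)%N ->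
  graded_part T ^+ (M + M) - graded_part T ^+ M = 3 *: Q ->
  y *m T ^+ m = y -> y *m T ^+ M = y.
Proof.
move=> fT m0 M0 eQ; pose P z := z *m T ^+ m = z.
pose E := T ^+ M - 1.
have PE z : P z -> P (z *m E).
  rewrite /P => e; rewrite -mulmxA mulmxE; have -> : E * T ^+ m = T ^+ m * E.
    by apply/commr_sym/commrB; [exact/commrX/commr_sym/commrX|exact: commr1].
  by rewrite -mulmxE mulmxA e.
pose low s z := forall i, (deg i < s)%N -> z 0 i = 0.
pose piece s z : 'rV[int]_N := \row_i (if deg i == s then z 0 i else 0).
have piece_mul s z A : filtered A -> low s z -> low s (z *m A) /\
    piece s (z *m A) = piece s z *m graded_part A.
  move=> fA lz; split.
    move=> j js; rewrite mxE big1 // => i _; have [is_|si] := ltnP (deg i) s.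
      by rewrite lz ?mul0r.
    by rewrite fA ?mulr0 // (leq_trans js).
  apply/rowP => j; rewrite !mxE; case: eqP => [js|/eqP js].
    apply: eq_bigr => i _; rewrite !mxE; have [is_|si|is_] := ltngtP (deg i) s.
    - by rewrite lz ?mul0r.
    - by rewrite mul0r fA ?mulr0 // js.
    - by rewrite is_ -js eqxx.
  rewrite big1 // => i _; rewrite !mxE; case: eqP => [->|]; rewrite ?mul0r //.
  by rewrite eq_sym (negbTE js) mulr0.
have raise s z : P z -> low s z -> low s.+1 (z *m E).
  move=> Pz lz; have [fM gM] := graded_part_exp M fT; have [fm gm] := graded_part_exp m fT.
  have [_ e1] := piece_mul s z _ fm lz; rewrite Pz gm in e1.
  have e2 := periodic_mod3 m0 M0 eQ (esym e1).
  have [lM e3] := piece_mul s z _ fM lz; rewrite gM e2 in e3.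
  move=> i; rewrite ltnS leq_eqVlt mulmxBr mulmx1 mxE [X in _ + X]mxE => /orP[/eqP is_|is_].
    by have := congr1 (fun A : 'rV_N => A 0 i) e3; rewrite [LHS]mxE [RHS]mxE is_ eqxx => ->; rewrite subrr.
  by rewrite lM // lz // subr0.
have lowk k z : P z -> low k (z *m E ^+ k) /\ P (z *m E ^+ k).
  elim: k => [|k IH] Pz; first by rewrite expr0 mulmx1.
  have [l1 P1] := IH Pz; rewrite exprSr -mulmxE mulmxA; split; [exact: raise|exact: PE].
move=> Py; pose D := (\max_i deg i).+1.
have exi : exists i, y *m E ^+ i == 0.
  exists D; apply/eqP/rowP => i; rewrite [RHS]mxE; have [lD _] := lowk D y Py; apply: lD.
  by rewrite /D ltnS leq_bigmax.
case: (ex_minnP exi) => [[|[|i]]] /eqP yi mini.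
- have -> : y = 0 by rewrite -yi expr0 mulmx1.
  by rewrite mul0mx.
- by move/eqP: yi; rewrite expr1 mulmxBr mulmx1 subr_eq0 => /eqP.
pose z := y *m E ^+ i; have Pz : P z by have [] := lowk i y Py.
have zEE : z *m E *m E = 0 by rewrite -yi /z !exprSr -!mulmxA -mulrA.
have Pit j : z *m T ^+ (m * j) = z.
  elim: j => [|j IH]; first by rewrite muln0 expr0 mulmx1.
  by rewrite mulnS exprD -mulmxE mulmxA Pz.
have := unipotent_iter m zEE; rewrite mulnC Pit => /eqP; rewrite eq_sym -subr_eq0 addrC addKr.
move=> /eqP/rowP mzE; have zE0 : z *m E = 0.
  apply/rowP => l; have := mzE l; rewrite [LHS]mxE => /eqP; rewrite [X in _ == X]mxE mulf_eq0.
  by rewrite pnatr_eq0 eqn0Ngt m0 /= => /eqP ->; rewrite mxE.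
have := mini i.+1; rewrite exprSr -mulmxE mulmxA -/z zE0 eqxx => /(_ isT).
by rewrite ltnn.
Qed.

End GradedOperators.

(** * A period valid in all truncation degrees *)

Section UniformPeriod.
Local Open Scope ring_scope.
Variables (n : nat) (b : 'I_n -> word n).
Notation f := (subst b).
Notation X := (fun k i => iter k f (letters i)).

Definition exponents (a : 'I_n -> word n) : 'M[int]_n :=
  \matrix_(i, j) magnus (a i) (@delta0 n) [:: j].

Lemma exponents_subst (a : 'I_n -> word n) :
  exponents (fun i => f (a i)) = exponents a *m exponents b.
Proof.
apply/matrixP => i j; rewrite !mxE -(@lin_ext_word _ _ b 1) // /lin_ext sum_mons.
rewrite mulr0 add0r; apply: eq_bigr => k _.
by rewrite big_seq1 !mxE /= {2}/delta0 /= subr0.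
Qed.

Lemma exponents_letters : exponents (@letters n) = 1%:M.
Proof.
apply/matrixP => i j; rewrite !mxE /= /mul_letter /= /mul_gen /delta0 /= add0r eq_sym.
by case: eqP.
Qed.

Lemma exponents_iter k : exponents (X k) = exponents b ^+ k.
Proof.
elim: k => [|k IH]; first exact: exponents_letters.
by rewrite exprSr -IH; exact: exponents_subst.
Qed.

(** The square of the number of n by n matrices over the field with three elements: one factor for
    the cycle length, one for the preperiod. *)
Definition period_bound := ((3 ^ (n * n)) * (3 ^ (n * n)))%N.

Lemma idempotent_power : exists M, [/\ (0 < M)%N, (M <= period_bound)%N &
  forall i j, (3 %| exponents (X (M + M)) i j - exponents (X M) i j)%Z].
Proof.
pose E : 'M['F_3]_n := map_mx intr (exponents b).
set S := (3 ^ (n * n))%N.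
have [i [j [ij jS eE]]] : exists i j, [/\ (i < j)%N, (j <= S)%N & E ^+ i = E ^+ j].
  apply: contrapT => no; pose c (k : 'I_S.+1) := E ^+ k.
  have inj : injective c.
    move=> k1 k2 e12; apply: val_inj => /=; have [lt|lt|//] := ltngtP k1 k2; exfalso; apply: no.
      by exists k1, k2; split; rewrite // -ltnS ltn_ord.
    by exists k2, k1; split; rewrite // -ltnS ltn_ord.
  by have := leq_card c inj; rewrite card_mx card_Fp // card_ord ltnn.
(* A multiple of the cycle length [d] that lies beyond the preperiod [i] is an idempotent exponent;
   [i.+1] keeps it positive. *)
pose d := (j - i)%N; exists (d * i.+1)%N.
have d0 : (0 < d)%N by rewrite subn_gt0.
have Ed t r : E ^+ (i + d * t + r) = E ^+ (i + r).
  elim: t => [|t IH]; first by rewrite muln0 addn0.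
  rewrite -IH mulnS (_ : (i + (d + d * t) + r = j + (d * t + r))%N); last by rewrite /d; lia.
  by rewrite exprD -eE -exprD addnA.
split; first by rewrite muln_gt0 d0.
  by rewrite /period_bound leq_mul // /d; lia.
have iM : (i <= d * i.+1)%N by apply: leq_trans (leq_pmull _ d0); exact: leqnSn.
set M := (d * i.+1)%N in iM *.
have EM : E ^+ (M + M) = E ^+ M.
  have := Ed i.+1 (M - i)%N; rewrite -/M => e.
  by rewrite (_ : (M + M = i + M + (M - i))%N) ?e; [congr (_ ^+ _)|]; lia.
move=> k l; have := congr1 (fun A : 'M_n => A k l) EM.
rewrite /E -!rmorphXn /= -!exponents_iter !mxE => /eqP.
rewrite -subr_eq0 -rmorphB /= => e.
by move: e; rewrite -[_ - _]/(_ - _); set z := _ - _; rewrite (dvdz_charf (char_Fp (isT : prime 3))).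
Qed.

Definition mon_deg c (i : 'I_(size (mons n c))) := size (nth [::] (mons n c) i).

Lemma filtered_mx_ext a c : filtered (@mon_deg c) (mx_ext a c).
Proof. by move=> i j ij; rewrite mxE mon_img_low. Qed.

Lemma mon_img_mod3 (a a' : 'I_n -> word n) V W :
  (forall i j, (3 %| exponents a i j - exponents a' i j)%Z) -> size V = size W ->
  (3 %| mon_img a V W - mon_img a' V W)%Z.
Proof.
move=> h; elim: V W => [|i V IH] [|j W] //.
move=> [sVW].
rewrite !mon_img_lead //; have := h i j; rewrite !mxE.
set x := magnus _ _ _; set x' := magnus _ _ _; set y := mon_img _ _ _; set y' := mon_img _ _ _.
move=> hx; have -> : x * y - x' * y' = (x - x') * y + x' * (y - y') by ring.
by apply: rpredD; [exact: dvdz_mulr|apply: dvdz_mull; exact: IH].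
Qed.

(** The quantifier order is the point: [M] precedes [c]. Diagonal blocks of all degrees inherit the
    congruence mod 3 from the exponent matrix. *)
Lemma uniform_period : exists M, [/\ (0 < M)%N, (M <= period_bound)%N &
  forall c m (y : 'rV_(size (mons n c))), (0 < m)%N ->
    y *m mx_ext b c ^+ m = y -> y *m mx_ext b c ^+ M = y].
Proof.
have [M [M0 hM h]] := idempotent_power; exists M; split=> // c m y m0.
set T := mx_ext b c.
have gE k : graded_part (@mon_deg c) T ^+ k = graded_part (@mon_deg c) (mx_ext (X k) c).
  have [_ <-] := graded_part_exp k (@filtered_mx_ext b c).
  by rewrite mx_ext_iter.
pose Q : 'M[int]_(size (mons n c)) := \matrix_(i, j)
  ((graded_part (@mon_deg c) T ^+ (M + M) - graded_part (@mon_deg c) T ^+ M) i j %/ 3)%Z.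
apply: (@filtered_periodic _ (@mon_deg c) _ Q) => //; first exact: filtered_mx_ext.
apply/matrixP => i j; rewrite [RHS]mxE [Q i j]mxE mulrC divzK //.
rewrite !gE !mxE; case: eqP => [eij|]; last by rewrite subrr dvdz0.
exact: mon_img_mod3.
Qed.

End UniformPeriod.

(** * Explicit bounds on matrices and vectors *)

Section Bounds.
Local Open Scope ring_scope.

Lemma mul_letter_bound n (l : 'I_n * bool) (g : seq 'I_n -> int) c (Z : int) :
  (forall W, (size W <= c)%N -> `|g W| <= Z) ->
  forall W, (size W <= c)%N -> `|mul_letter l g W| <= c.+1%:R * Z.
Proof.
move=> hg W sW; have Z0 : 0 <= Z by apply: le_trans (hg [::] _).
(* Under (1 + X_i)^-1 the coefficient of [W] is an alternating sum of at most [(size W).+1]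
   coefficients of [g]. *)
suff h : `|mul_letter l g W| <= (size W).+1%:R * Z.
  by apply: le_trans h _; apply: ler_wpM2r => //; rewrite ler_nat.
case: l => i []; rewrite /mul_letter /=.
  elim: W sW => [|j W IH] sW /=; first by rewrite subr0 mul1r hg.
  have IH' := IH (ltnW sW).
  case: ifP => _; last by rewrite subr0; apply: le_trans (hg _ sW) _; rewrite ler_peMl // ler1n.
  apply: le_trans (ler_normB _ _) _; rewrite -[_.+2%:R]natr1 mulrDl mul1r addrC.
  by apply: lerD => //; exact: hg.
rewrite /mul_gen; case: W sW => [|j W] sW; first by rewrite addr0 mul1r hg.
apply: le_trans (ler_normD _ _) _; apply: (@le_trans _ _ (Z + Z)).
  apply: lerD; first exact: hg.
  by case: ifP => _; rewrite ?normr0 // hg // ltnW.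
have -> : Z + Z = 2%:R * Z by ring.
by apply: ler_wpM2r; rewrite // ler_nat.
Qed.

Lemma magnus_bound n (w : word n) (g : seq 'I_n -> int) c (Z : int) :
  (forall W, (size W <= c)%N -> `|g W| <= Z) ->
  forall W, (size W <= c)%N -> `|magnus w g W| <= (c.+1 ^ size w)%:R * Z.
Proof.
move=> hg; elim: w => [|l w IH] W sW; first by rewrite mul1r hg.
by rewrite magnus_cons expnS natrM -mulrA; apply: mul_letter_bound.
Qed.

Lemma delta0_bound n c (W : seq 'I_n) : (size W <= c)%N -> `|delta0 W| <= 1.
Proof. by move=> _; rewrite /delta0; case: eqP. Qed.

(** Each of the at most [c] factors [b i - 1] costs (c + 1)^L for the word and 1 for the
    subtraction. *)
Definition entry_bound c L := ((c.+1 ^ L).+1 ^ c)%N.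

Lemma mon_img_bound m n (b : 'I_m -> word n) c L V W : (forall i, (size (b i) <= L)%N) ->
  (size V <= c)%N -> (size W <= c)%N -> `|mon_img b V W| <= (entry_bound c L)%:R.
Proof.
move=> hb sV sW; apply: (@le_trans _ _ (((c.+1 ^ L).+1 ^ size V)%N%:R)); last first.
  by rewrite ler_nat leq_pexp2l.
elim: V sV W sW => [|i V IH] sV W sW /=; first exact: delta0_bound sW.
have IH' U : (size U <= c)%N -> `|mon_img b V U| <= ((c.+1 ^ L).+1 ^ size V)%:R.
  by apply: IH; exact: ltnW.
apply: le_trans (ler_normB _ _) _; rewrite expnS mulSn natrD addrC; apply: lerD; first exact: IH'.
apply: le_trans (magnus_bound (b i) IH' sW) _.
by rewrite natrM ler_wpM2r ?ler0n // ler_nat leq_pexp2l.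
Qed.

Definition mon_count n c := iter c (fun z => (n * z).+1)%N 1%N.

(** The successor ensures the positivity required of [a] in [linear_orbit]. *)
Definition norm_bound n c L := (mon_count n c * entry_bound c L).+1.

Lemma mx_ext_bound n (b : 'I_n -> word n) c L (v : 'rV_(size (mons n c))) :
  (forall i, (size (b i) <= L)%N) ->
  row_norm (v *m mx_ext b c) <= (norm_bound n c L)%:R * row_norm v.
Proof.
move=> hb; have T_le i j : `|mx_ext b c i j| <= (entry_bound c L)%:R.
  by rewrite mxE; apply: mon_img_bound => //; exact: size_nth_mons.
apply: (@le_trans _ _ ((mon_count n c * entry_bound c L)%:R * row_norm v)); last first.
  by apply: ler_wpM2r; [exact: row_norm_ge0|rewrite ler_nat].
rewrite natrM -mulrA -[X in X%:R * _]/(mon_count n c) /mon_count -size_mons.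
rewrite -[X in X%:R * _](card_ord (size (mons n c))) mulr_natl -sumr_const.
apply: ler_sum => j _; rewrite mxE; apply: le_trans (ler_norm_sum _ _ _) _.
rewrite mulr_sumr; apply: ler_sum => i _; rewrite normrM mulrC.
by apply: ler_wpM2r.
Qed.

Lemma wvec_bound n c (w : word n) l : (size w <= l)%N ->
  row_norm (wvec c w) <= (mon_count n c * c.+1 ^ l)%:R.
Proof.
move=> sw; rewrite natrM /mon_count -size_mons -[X in X%:R * _](card_ord (size (mons n c))).
rewrite mulr_natl -sumr_const; apply: ler_sum => j _; rewrite mxE.
apply: le_trans (magnus_bound w (@delta0_bound n c) (size_nth_mons j)) _.
by rewrite mulr1 ler_nat leq_pexp2l.
Qed.

End Bounds.

(** * A computable bound for the exponents *)

Section BoundedSearch.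
Variables (n : nat) (b : 'I_n -> word n) (L : nat).
Hypothesis b_size : forall i, size (b i) <= L.
Notation f := (subst b).

Lemma size_subst w : size (f w) <= L.+1 * size w.
Proof.
elim: w => [|l w IH]; first by rewrite muln0.
rewrite subst_cons size_cat /= mulnS; apply: leq_add IH.
by case: l.2; rewrite ?size_word_inv leqW.
Qed.

Lemma size_iter_subst k w : size (iter k f w) <= L.+1 ^ k * size w.
Proof.
elim: k => [|k IH]; first by rewrite mul1n.
by rewrite /= expnS -mulnA; apply: leq_trans (size_subst _) _; rewrite leq_mul2l IH orbT.
Qed.

(** Both f^M(f^n(v)) and f^n(v) have length at most half of this, as [wvec_weq] demands for telling
    them apart. *)
Definition degree_bound := (L.+1 ^ (n + period_bound n).+1).*2.

Definition word_bound := let c := degree_bound in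
  mon_count n c * c.+1 ^ (L.+1 ^ n.+1).

Definition shift_bound := let c := degree_bound in
  period_bound n + orbit_bound (mon_count n c) (norm_bound n c L) word_bound.

Definition search_bound := n + shift_bound.

Lemma one_sided_bound u v k : size u <= L -> size v <= L ->
  weq (iter k f (iter n f u)) (iter n f v) ->
  exists2 k', k' <= shift_bound & weq (iter k' f (iter n f u)) (iter n f v).
Proof.
move=> su sv ek; have [M [M0 hM per]] := uniform_period b.
have exk : exists k, `[< weq (iter k f (iter n f u)) (iter n f v) >].
  by exists k; exact/asboolP.
case: (ex_minnP exk) => {ek}k /asboolP ek mink; exists k => //.
set u' := iter n f u in ek mink *; set v' := iter n f v in ek mink *.
have [vper|vnper] := pselect (weq (iter M f v') v').
  have [lekM|ltMk] := leqP k M.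
    by apply: leq_trans lekM (leq_trans hM _); exact: leq_addr.
  (* Both sides agree after [M] further steps, since f^M fixes [v']; these steps can be cancelled on
     f^n(F), against the minimality of [k]. *)
  suff /asboolP/mink : weq (iter (k - M) f u') v' by lia.
  rewrite /u' -iterD addnC iterD; apply: (@eventually_equal _ _ (M + n)).
  rewrite -!iterD -/v' (_ : M + n + (k - M) = k + n); last by lia.
  by rewrite iterD -/u' /weq ek -vper iterD.
(* A larger [k] would make the vector of [v'] periodic, hence of period [M], and [c] is large enough
   to turn this into f^M(v') = v' for words. *)
rewrite leqNgt; apply/negP => /ltnW ltk; apply: vnper.
set c := degree_bound; set l := L.+1 ^ n.+1.
have sl w : size w <= L -> size (iter n f w) <= l.
  move=> sw; apply: leq_trans (size_iter_subst n w) _.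
  by rewrite /l expnSr leq_mul2l leqW ?orbT.
have X0 : 0 < word_bound.
  by rewrite muln_gt0 expn_gt0 /= andbT /mon_count; case: degree_bound.
have hx := wvec_bound c (sl u su); have hy := wvec_bound c (sl v sv).
have exy : (wvec c u' *m mx_ext b c ^+ k = wvec c v')%R by rewrite -wvec_iter /wvec ek.
have T_bound := mx_ext_bound _ b_size.
have [|m m0 ym] := @linear_orbit _ _ _ (ltn0Sn _) (fun v => T_bound c v) _ _ _ k X0 hx hy exy.
  rewrite size_mons; apply: leq_trans ltk; exact: leq_addl.
have yM := per c m _ m0 ym.
apply: (@wvec_weq _ _ _ c); last by rewrite wvec_iter.
rewrite /c /degree_bound -addnn; apply: leq_add.
  rewrite /v' -iterD; apply: leq_trans (size_iter_subst _ _) _.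
  rewrite expnSr; apply: leq_mul; last exact: leqW.
  by rewrite leq_pexp2l // addnC leq_add2l.
apply: leq_trans (sl v sv) _; rewrite /l leq_pexp2l // ltnS; exact: leq_addr.
Qed.

Theorem orbit_search_bound u v p q : size u <= L -> size v <= L ->
  weq (iter p f u) (iter q f v) ->
  exists p' q', [/\ p' <= search_bound, q' <= search_bound &
    weq (iter p' f u) (iter q' f v)].
Proof.
have main u' v' p' q' : size u' <= L -> size v' <= L -> q' <= p' ->
    weq (iter p' f u') (iter q' f v') ->
    exists2 k, k <= shift_bound & weq (iter (k + n) f u') (iter n f v').
  move=> su sv qp e.
  have {}e : weq (iter (p' - q') f (iter n f u')) (iter n f v').
    rewrite -iterD addnC iterD; apply: (@eventually_equal _ _ q').
    by rewrite -iterD subnKC.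
  have [k hk ek] := one_sided_bound su sv e; exists k => //.
  by rewrite iterD.
move=> su sv e; have [qp|/ltnW pq] := leqP q p.
  have [k hk ek] := main _ _ _ _ su sv qp e.
  by exists (k + n), n; split; rewrite // /search_bound; [rewrite addnC leq_add2l|exact: leq_addr].
have [k hk ek] := main _ _ _ _ sv su pq (esym e).
exists n, (k + n); split; [exact: leq_addr|by rewrite addnC leq_add2l|].
exact: esym ek.
Qed.

End BoundedSearch.

(** * Recursive functions on codes of words *)

Section Computability.

Definition computable n (F : n.-tuple nat -> nat) :=
  exists g : murec n, forall x, computes g x (F x).

Lemma computable_ext n (F G : n.-tuple nat -> nat) : F =1 G -> computable F -> computable G.
Proof. by move=> e [g hg]; exists g => x; rewrite -e. Qed.

Lemma computable_tnth n (i : 'I_n) : computable (fun x => tnth x i).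
Proof. by exists (MuProj i). Qed.

Lemma computable_comp m n (F : m.-tuple nat -> nat) (G : 'I_m -> n.-tuple nat -> nat) :
  computable F -> (forall i, computable (G i)) -> computable (fun x => F [tuple G i x | i < m]).
Proof.
move=> [f hf] /choice[g hg]; exists (MuComp f g) => x /=.
by exists [tuple G i x | i < m] => // i; rewrite tnth_mktuple.
Qed.

Lemma computable_succ n (F : n.-tuple nat -> nat) : computable F -> computable (fun x => (F x).+1).
Proof.
move=> hF; have h : computable (fun x : 1.-tuple nat => (thead x).+1) by exists MuSucc.
apply: computable_ext (computable_comp h (fun=> hF)) => x.
by rewrite /thead tnth_mktuple.
Qed.

Lemma computable_const n c : computable (fun _ : n.-tuple nat => c).
Proof. by elim: c => [|c IH]; [exists (MuZero n)|exact: computable_succ]. Qed.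

Lemma behead_tuple_cons n k (x : n.-tuple nat) : behead_tuple [tuple of k :: x] = x.
Proof. exact: val_inj. Qed.

Lemma tnth_behead_tuple n (x : n.+1.-tuple nat) i : tnth (behead_tuple x) i = tnth x (lift ord0 i).
Proof. by case/tupleP: x => k x; rewrite behead_tuple_cons tnthS. Qed.

Lemma computable_behead n (F : n.-tuple nat -> nat) :
  computable F -> computable (fun x : n.+1.-tuple nat => F (behead_tuple x)).
Proof.
move=> hF; apply: computable_ext (computable_comp hF (fun i => computable_tnth (lift ord0 i))) => x.
by congr F; apply: eq_from_tnth => i; rewrite tnth_mktuple tnth_behead_tuple.
Qed.

Lemma computable_cons m n (K : m.-tuple nat -> nat) (P : 'I_n -> m.-tuple nat -> nat)
    (F : n.+1.-tuple nat -> nat) : computable K -> (forall i, computable (P i)) ->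
  computable F -> computable (fun x => F [tuple of K x :: [tuple P i x | i < n]]).
Proof.
move=> hK hP hF; pose G (i : 'I_n.+1) := if unlift ord0 i is Some j then P j else K.
have hG i : computable (G i) by rewrite /G; case: unlift.
apply: computable_ext (computable_comp hF hG) => x; congr F.
apply: eq_from_tnth => i; rewrite tnth_mktuple /G.
by case: unliftP => [j ->|->]; rewrite ?tnthS ?tnth_mktuple.
Qed.

Lemma mktuple_tnth n (x : n.-tuple nat) : [tuple tnth x i | i < n] = x.
Proof. by apply: eq_from_tnth => i; rewrite tnth_mktuple. Qed.

(** The parameters [x] stay visible to the step function, while [MuRec] recurses on its first
    argument. The functions below are first put in this [nat_rect] form. *)
Lemma computable_rec n (K F : n.-tuple nat -> nat) (H : nat -> nat -> n.-tuple nat -> nat) :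
  computable K -> computable F ->
  computable (fun z : n.+2.-tuple nat => H (tnth z ord0) (tnth z (lift ord0 ord0))
    (behead_tuple (behead_tuple z))) ->
  computable (fun x => nat_rect (fun=> nat) (F x) (fun k r => H k r x) (K x)).
Proof.
move=> hK [f hf] [h hh].
pose R (x : n.+1.-tuple nat) := nat_rect (fun=> nat) (F (behead_tuple x))
  (fun k r => H k r (behead_tuple x)) (thead x).
have hR : computable R.
  exists (MuRec f h) => x /=.
  exists (nat_rect (fun=> nat) (F (behead_tuple x)) (fun k r => H k r (behead_tuple x))).
  split=> // k _ /=; set z := [tuple of _]; have := hh z.
  have -> : behead_tuple (behead_tuple z) = behead_tuple x by apply: val_inj.
  by [].
apply: computable_ext (computable_cons hK (@computable_tnth n) hR) => x.
by rewrite /R theadE behead_tuple_cons mktuple_tnth.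
Qed.

Definition computable1 (f : nat -> nat) := computable (fun x : 1.-tuple nat => f (tnth x ord0)).
Definition computable2 (f : nat -> nat -> nat) :=
  computable (fun x : 2.-tuple nat => f (tnth x ord0) (tnth x (lift ord0 ord0))).
Definition computable3 (f : nat -> nat -> nat -> nat) :=
  computable (fun x : 3.-tuple nat =>
    f (tnth x ord0) (tnth x (lift ord0 ord0)) (tnth x (lift ord0 (lift ord0 ord0)))).

Lemma computable1_app f n (F : n.-tuple nat -> nat) :
  computable1 f -> computable F -> computable (fun x => f (F x)).
Proof.
move=> hf hF; apply: computable_ext (computable_comp hf (fun=> hF)) => x.
by rewrite tnth_mktuple.
Qed.

Lemma computable2_app f n (F G : n.-tuple nat -> nat) :
  computable2 f -> computable F -> computable G -> computable (fun x => f (F x) (G x)).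
Proof.
move=> hf hF hG; pose T (i : 'I_2) := if i == ord0 then F else G.
have hT i : computable (T i) by rewrite /T; case: ifP.
by apply: computable_ext (computable_comp hf hT) => x; rewrite !tnth_mktuple.
Qed.

Lemma computable3_app f n (F G E : n.-tuple nat -> nat) :
  computable3 f -> computable F -> computable G -> computable E ->
  computable (fun x => f (F x) (G x) (E x)).
Proof.
move=> hf hF hG hE.
pose T (i : 'I_3) := if i == ord0 then F else if i == lift ord0 ord0 then G else E.
have hT i : computable (T i) by rewrite /T; case: ifP => // _; case: ifP.
by apply: computable_ext (computable_comp hf hT) => x; rewrite !tnth_mktuple.
Qed.

Lemma computable_tnth2 n (i : 'I_n) :
  computable (fun z : n.+2.-tuple nat => tnth (behead_tuple (behead_tuple z)) i).
Proof. exact: (computable_behead (computable_behead (computable_tnth i))). Qed.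

End Computability.

Create HintDb comp.
#[local] Hint Resolve computable_tnth computable_tnth2 computable_const computable_succ : comp.
Ltac comp := auto 100 with comp.

Lemma comp_add n (F G : n.-tuple nat -> nat) : computable F -> computable G ->
  computable (fun x => F x + G x).
Proof.
move=> hF hG; apply: (@computable_ext _ (fun x => nat_rect (fun=> nat) (G x) (fun _ r => r.+1) (F x))).
  by move=> x; elim: (F x) => //= k ->.
by apply: (@computable_rec _ _ _ (fun _ r _ => r.+1)); comp.
Qed.
#[local] Hint Resolve comp_add : comp.

Lemma comp_mul n (F G : n.-tuple nat -> nat) : computable F -> computable G ->
  computable (fun x => F x * G x).
Proof.
apply: computable2_app; pose a (x : 2.-tuple nat) := tnth x (lift ord0 ord0).
apply: (@computable_ext _ (fun x => nat_rect (fun=> nat) 0 (fun _ r => a x + r) (tnth x ord0))).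
  by move=> x; elim: (tnth x ord0) => //= k ->; rewrite mulSn.
by apply: (@computable_rec _ _ _ (fun _ r x => a x + r)); rewrite /a; comp.
Qed.
#[local] Hint Resolve comp_mul : comp.

Lemma comp_exp n (F G : n.-tuple nat -> nat) : computable F -> computable G ->
  computable (fun x => F x ^ G x).
Proof.
apply: computable2_app.
apply: (@computable_ext _ (fun x : 2.-tuple nat => nat_rect (fun=> nat) 1
  (fun _ r => tnth x ord0 * r) (tnth x (lift ord0 ord0)))).
  by move=> x; elim: (tnth x (lift ord0 ord0)) => //= k ->; rewrite expnS.
by apply: (@computable_rec _ _ _ (fun _ r x => tnth x ord0 * r)); comp.
Qed.
#[local] Hint Resolve comp_exp : comp.

Lemma comp_fact n (F : n.-tuple nat -> nat) : computable F -> computable (fun x => (F x)`!).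
Proof.
move=> hF; apply: (@computable_ext _ (fun x => nat_rect (fun=> nat) 1 (fun k r => k.+1 * r) (F x))).
  by move=> x; elim: (F x) => //= k ->; rewrite factS.
by apply: (@computable_rec _ _ _ (fun k r _ => k.+1 * r)); comp.
Qed.
#[local] Hint Resolve comp_fact : comp.

Lemma comp_double n (F : n.-tuple nat -> nat) : computable F -> computable (fun x => (F x).*2).
Proof. by move=> hF; apply: (@computable_ext _ (fun x => F x + F x)) => [x|]; rewrite ?addnn; comp. Qed.
#[local] Hint Resolve comp_double : comp.

Lemma comp_pred n (F : n.-tuple nat -> nat) : computable F -> computable (fun x => (F x).-1).
Proof.
move=> hF; apply: (@computable_ext _ (fun x => nat_rect (fun=> nat) 0 (fun k _ => k) (F x))).
  by move=> x; case: (F x).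
by apply: (@computable_rec _ _ _ (fun k _ _ => k)); comp.
Qed.
#[local] Hint Resolve comp_pred : comp.

Lemma comp_sub n (F G : n.-tuple nat -> nat) : computable F -> computable G ->
  computable (fun x => F x - G x).
Proof.
move=> hF hG; apply: (@computable_ext _ (fun x => nat_rect (fun=> nat) (F x) (fun _ r => r.-1) (G x))).
  by move=> x; elim: (G x) => [|k /= ->]; rewrite ?subn0 ?subnS.
by apply: (@computable_rec _ _ _ (fun _ r _ => r.-1)); comp.
Qed.
#[local] Hint Resolve comp_sub : comp.

Definition ifz (a b c : nat) := if a is 0 then b else c.

Lemma comp_ifz n (F G H : n.-tuple nat -> nat) : computable F -> computable G -> computable H ->
  computable (fun x => ifz (F x) (G x) (H x)).
Proof.
apply: computable3_app; pose c (x : 3.-tuple nat) := tnth x (lift ord0 (lift ord0 ord0)).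
apply: (@computable_ext _ (fun x => nat_rect (fun=> nat) (tnth x (lift ord0 ord0))
  (fun _ _ => c x) (tnth x ord0))).
  by move=> x; case: (tnth x ord0).
by apply: (@computable_rec _ _ _ (fun _ _ x => c x)); rewrite /c; comp.
Qed.
#[local] Hint Resolve comp_ifz : comp.

Lemma comp_odd n (F : n.-tuple nat -> nat) : computable F -> computable (fun x => nat_of_bool (odd (F x))).
Proof.
move=> hF; apply: (@computable_ext _ (fun x => nat_rect (fun=> nat) 0 (fun _ r => 1 - r) (F x))).
  by move=> x; elim: (F x) => //= k ->; case: (odd k).
by apply: (@computable_rec _ _ _ (fun _ r _ => 1 - r)); comp.
Qed.
#[local] Hint Resolve comp_odd : comp.

Lemma comp_half n (F : n.-tuple nat -> nat) : computable F -> computable (fun x => (F x)./2).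
Proof.
(* Half of k + 1 is k minus half of k. *)
move=> hF; apply: (@computable_ext _ (fun x => nat_rect (fun=> nat) 0 (fun k r => k - r) (F x))).
  by move=> x; elim: (F x) => //= k ->; have := uphalfE k; lia.
by apply: (@computable_rec _ _ _ (fun k r _ => k - r)); comp.
Qed.
#[local] Hint Resolve comp_half : comp.

(** * Arithmetic of list codes *)

Notation ccode := CodeSeq.code.

(** The nonempty clause of [CodeSeq.code]: the head is the exponent of 2, the tail is half of the
    odd part after rounding down. The empty list has code 0. *)
Definition ccons x s := 2 ^ x * s.*2.+1.

Lemma comp_ccons n (F G : n.-tuple nat -> nat) : computable F -> computable G ->
  computable (fun x => ccons (F x) (G x)).
Proof. by rewrite /ccons => hF hG; comp. Qed.
#[local] Hint Resolve comp_ccons : comp.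

Lemma code_cons x s : ccode (x :: s) = ccons x (ccode s). Proof. by []. Qed.

(* The odd part of m is reached after at most m halvings. *)
Definition cstrip k m := nat_rect (fun=> nat) m (fun _ r => ifz (odd r) r./2 r) k.
Definition ctail m := (cstrip m m)./2.
Definition chead m := nat_rect (fun=> nat) 0 (fun k r => r + (1 - odd (cstrip k m))) m.

Lemma comp_cstrip n (F G : n.-tuple nat -> nat) : computable F -> computable G ->
  computable (fun x => cstrip (F x) (G x)).
Proof.
move=> hF hG; rewrite /cstrip.
by apply: (@computable_rec _ _ _ (fun _ r _ => ifz (odd r) r./2 r)); comp.
Qed.
#[local] Hint Resolve comp_cstrip : comp.

Lemma comp_ctail n (F : n.-tuple nat -> nat) : computable F -> computable (fun x => ctail (F x)).
Proof. by rewrite /ctail => hF; comp. Qed.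
#[local] Hint Resolve comp_ctail : comp.

Lemma comp_chead n (F : n.-tuple nat -> nat) : computable F -> computable (fun x => chead (F x)).
Proof.
apply: computable1_app; rewrite /computable1 /chead.
by apply: (@computable_rec _ _ _ (fun k r x => r + (1 - odd (cstrip k (tnth x ord0))))); comp.
Qed.
#[local] Hint Resolve comp_chead : comp.

Lemma ccons0 s : ccons 0 s = s.*2.+1. Proof. exact: mul1n. Qed.

Lemma cconsS x s : ccons x.+1 s = (ccons x s).*2.
Proof. by rewrite /ccons expnS -mulnA mul2n. Qed.

Lemma odd_ccons x s : odd (ccons x s) = (x == 0).
Proof. by case: x => [|x]; rewrite ?ccons0 ?cconsS /= odd_double. Qed.

Lemma cstrip_cons k x s : cstrip k (ccons x s) = ccons (x - k) s.
Proof.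
elim: k => [|k IH]; first by rewrite subn0.
have -> : cstrip k.+1 (ccons x s) = ifz (odd (cstrip k (ccons x s))) (cstrip k (ccons x s))./2
  (cstrip k (ccons x s)) by [].
rewrite IH odd_ccons subnS; case: (x - k) => [|y] //=.
by rewrite cconsS doubleK.
Qed.

Lemma lt_ccons x s : x < ccons x s.
Proof. by apply: leq_trans (ltn_expl x (ltnSn 1)) _; rewrite /ccons leq_pmulr. Qed.

Lemma ctail_cons x s : ctail (ccons x s) = s.
Proof.
rewrite /ctail cstrip_cons (_ : x - _ = 0) ?ccons0 /= ?uphalf_double //.
by apply/eqP; rewrite subn_eq0 ltnW // lt_ccons.
Qed.

Lemma chead_cons x s : chead (ccons x s) = x.
Proof.
have h k : nat_rect (fun=> nat) 0 (fun k r => r + (1 - odd (cstrip k (ccons x s)))) k = minn k x.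
  elim: k => [|k IH]; first by rewrite min0n.
  rewrite [LHS]/= IH cstrip_cons odd_ccons subn_eq0; case: (leqP x k) => xk; lia.
by rewrite /chead h; apply/minn_idPr/ltnW/lt_ccons.
Qed.

Lemma ctail_code s : ctail (ccode s) = ccode (behead s).
Proof. by case: s => [|x s] //; rewrite code_cons ctail_cons. Qed.

Lemma gt_ccons x s : s < ccons x s.
Proof. by apply: leq_trans (leq_pmull _ (_ : 0 < 2 ^ x)); rewrite ?expn_gt0 // ltnS -addnn leq_addr. Qed.

Lemma size_le_code s : size s <= ccode s.
Proof. by elim: s => //= x s IH; apply: leq_ltn_trans IH (gt_ccons x _). Qed.

Lemma mem_le_code x s : x \in s -> x <= ccode s.
Proof.
elim: s => // y s IH; rewrite inE code_cons => /orP[/eqP ->|/IH h]; first exact/ltnW/lt_ccons.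
exact: leq_trans h (ltnW (gt_ccons y _)).
Qed.

Definition cdrop k m := nat_rect (fun=> nat) m (fun _ r => ctail r) k.

Lemma comp_cdrop n (F G : n.-tuple nat -> nat) : computable F -> computable G ->
  computable (fun x => cdrop (F x) (G x)).
Proof. by move=> hF hG; apply: (@computable_rec _ _ _ (fun _ r _ => ctail r)); comp. Qed.
#[local] Hint Resolve comp_cdrop : comp.

Lemma cdrop_code k s : cdrop k (ccode s) = ccode (drop k s).
Proof.
elim: k => [|k IH]; first by rewrite drop0.
by rewrite /= -/(cdrop k _) IH ctail_code -drop1 drop_drop.
Qed.

Definition cnth k m := chead (cdrop k m).

Lemma comp_cnth n (F G : n.-tuple nat -> nat) : computable F -> computable G ->
  computable (fun x => cnth (F x) (G x)).
Proof. by rewrite /cnth => hF hG; comp. Qed.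
#[local] Hint Resolve comp_cnth : comp.

Lemma cnth_code k s : k < size s -> cnth k (ccode s) = nth 0 s k.
Proof. by move=> ks; rewrite /cnth cdrop_code (drop_nth 0 ks) code_cons chead_cons. Qed.

(** A list is no longer than its code, so [m] rounds suffice; once the list is exhausted the code is
    0 and the accumulator no longer changes. *)
Definition cfold (F : nat -> nat -> nat) a m :=
  nat_rect (fun=> nat) a (fun k r => ifz (cdrop k m) r (F r (chead (cdrop k m)))) m.

Lemma comp_cfold n (F : nat -> nat -> n.-tuple nat -> nat) (A M : n.-tuple nat -> nat) :
  computable A -> computable M ->
  computable (fun z : n.+2.-tuple nat => F (tnth z ord0) (tnth z (lift ord0 ord0))
    (behead_tuple (behead_tuple z))) ->
  computable (fun x => cfold (fun r l => F r l x) (A x) (M x)).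
Proof.
move=> hA hM hF; rewrite /cfold.
apply: (@computable_rec _ _ _ (fun k r x => ifz (cdrop k (M x)) r (F r (chead (cdrop k (M x))) x))) => //.
have hM2 := computable_behead (computable_behead hM).
apply: comp_ifz; [by comp|by comp|].
pose P (i : 'I_n) (z : n.+2.-tuple nat) := tnth (behead_tuple (behead_tuple z)) i.
pose P2 (i : 'I_n.+1) (z : n.+2.-tuple nat) := if unlift ord0 i is Some j then P j z else
  chead (cdrop (tnth z ord0) (M (behead_tuple (behead_tuple z)))).
have hP2 i : computable (P2 i) by rewrite /P2 /P; case: unlift => [j|]; comp.
apply: computable_ext (computable_cons (computable_tnth (lift ord0 ord0)) hP2 hF) => z.
rewrite behead_tuple_cons tnth0 tnthS tnth_mktuple /P2 unlift_none; congr F.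
apply: eq_from_tnth => i; by rewrite tnth_behead_tuple tnth_mktuple liftK.
Qed.

Lemma cfold_code F a s : cfold F a (ccode s) = foldl F a s.
Proof.
pose G k r := ifz (cdrop k (ccode s)) r (F r (chead (cdrop k (ccode s)))).
have h k : nat_rect (fun=> nat) a G k = foldl F a (take k s).
  elim: k => [|k IH]; first by rewrite take0.
  rewrite /= IH /G cdrop_code; have [sk|ks] := leqP (size s) k.
    by rewrite drop_oversize //= !take_oversize // leqW.
  by rewrite (drop_nth 0 ks) code_cons chead_cons (take_nth 0 ks) foldl_rcons /ccons -[_ * _]prednK // muln_gt0 expn_gt0.
by rewrite /cfold -/G h take_oversize // size_le_code.
Qed.

(** * Programs on codes of words *)

Section WordPrograms.
Variable n : nat.
Implicit Types (w u v st : word n).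

Definition letter_num (l : 'I_n * bool) := l.1.*2 + l.2.

Lemma code_wordE w : code_word w = ccode (map letter_num w). Proof. by []. Qed.

Lemma letter_num_inj : injective letter_num.
Proof.
move=> [i b] [j c]; rewrite /letter_num /= => e.
have eb : b = c by case: b c e => [] []; lia.
by subst c; congr (_, _); apply: val_inj => /=; lia.
Qed.

Lemma odd_letter_num l : odd (letter_num l) = l.2.
Proof. by rewrite /letter_num oddD odd_double; case: l.2. Qed.

Lemma half_letter_num l : (letter_num l)./2 = l.1.
Proof. by rewrite /letter_num addnC half_bit_double. Qed.

Definition cinv l := ifz (odd l) l.+1 l.-1.

Lemma cinv_letter l : cinv (letter_num l) = letter_num (letter_inv l).
Proof.
by rewrite /cinv odd_letter_num /letter_num; case: l => i []; rewrite /= ?addn1 ?addn0.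
Qed.

(** The sum of the two truncated differences vanishes exactly when the codes are equal. *)
Definition cpush s c := ifz s (ccons c 0)
  (ifz ((chead s - cinv c) + (cinv c - chead s)) (ctail s) (ccons c s)).

Lemma code_word_cons l w : code_word (l :: w) = ccons (letter_num l) (code_word w).
Proof. by []. Qed.

Lemma ifz_ccons x s c d : ifz (ccons x s) c d = d.
Proof. by have := lt_ccons x s; case: (ccons x s). Qed.

Lemma cpush_code st l : cpush (code_word st) (letter_num l) = code_word (push st l).
Proof.
case: st => // l' st; rewrite /cpush cinv_letter code_word_cons ifz_ccons chead_cons ctail_cons /push.
case: eqP => [->|/eqP ne]; first by rewrite subnn.
rewrite 2!code_word_cons; set d := _ + _.
have : d != 0 by have := contra_neq (@letter_num_inj l' (letter_inv l)) ne; rewrite /d; lia.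
by case: d.
Qed.

Lemma foldl_letters (F : nat -> nat -> nat) (G : word n -> 'I_n * bool -> word n) st w :
  (forall st l, F (code_word st) (letter_num l) = code_word (G st l)) ->
  cfold F (code_word st) (code_word w) = code_word (foldl G st w).
Proof.
by move=> h; rewrite code_wordE cfold_code; elim: w st => //= l w IH st; rewrite h IH.
Qed.

Definition crev m := cfold (fun r l => ccons l r) 0 m.
Definition ccatrev a m := cfold (fun r l => ccons l r) a m.
Definition cinvcat a m := cfold (fun r l => ccons (cinv l) r) a (crev m).

Lemma foldl_cons (T : Type) (s r : seq T) : foldl (fun r l => l :: r) r s = rev s ++ r.
Proof. by elim: s r => //= x s IH r; rewrite IH rev_cons cat_rcons. Qed.

Lemma crev_word w : crev (code_word w) = code_word (rev w).
Proof. by rewrite /crev (@foldl_letters _ (fun r l => l :: r) [::]) // foldl_cons cats0. Qed.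

Lemma ccatrev_word st w : ccatrev (code_word st) (code_word w) = code_word (rev w ++ st).
Proof. by rewrite /ccatrev (@foldl_letters _ (fun r l => l :: r)) // foldl_cons. Qed.

Lemma cinvcat_word st w : cinvcat (code_word st) (code_word w) = code_word (rev (word_inv w) ++ st).
Proof.
rewrite /cinvcat crev_word (@foldl_letters _ (fun r l => letter_inv l :: r)) => [|st' l]; last first.
  by rewrite cinv_letter.
suff -> : foldl (fun r l => letter_inv l :: r) st (rev w) = rev (word_inv w) ++ st by [].
rewrite /word_inv revK -[w in RHS]revK; elim: (rev w) st => //= l s IH st.
by rewrite IH rev_cons map_rcons cat_rcons.
Qed.

(** Left folds build words from the top of a stack, so the image is accumulated in reverse order and
    reversed once at the end. *)
Definition csubst ws m := crev (cfold (fun r c =>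
  ifz (odd c) (ccatrev r (cnth c./2 ws)) (cinvcat r (cnth c./2 ws))) 0 m).

Lemma csubst_word (b : n.-tuple (word n)) w :
  csubst (code_words b) (code_word w) = code_word (subst (tnth b) w).
Proof.
have cb (i : 'I_n) : cnth i (code_words b) = code_word (tnth b i).
  rewrite cnth_code ?size_map ?size_tuple // (nth_map [::]) ?size_tuple //.
  by rewrite -tnth_nth.
pose G st (l : 'I_n * bool) := rev (if l.2 then word_inv (tnth b l.1) else tnth b l.1) ++ st.
rewrite /csubst (@foldl_letters _ G [::]) => [|st l]; last first.
  by rewrite odd_letter_num half_letter_num cb /G; case: l.2; rewrite ?cinvcat_word ?ccatrev_word.
rewrite crev_word; congr code_word; rewrite -[subst _ _]revK; congr rev.
rewrite -[RHS]cats0; elim: w [::] => //= l w IH st.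
by rewrite IH subst_cons rev_cat catA.
Qed.

Definition citer ws m k := nat_rect (fun=> nat) m (fun _ r => csubst ws r) k.

Lemma citer_word (b : n.-tuple (word n)) w k :
  citer (code_words b) (code_word w) k = code_word (iter k (subst (tnth b)) w).
Proof. by elim: k => //= k IH; rewrite -/(citer _ _ k) IH csubst_word. Qed.

(** Free reduction of f^p(u) f^q(v)^-1 in two stack passes; the value is 0 exactly when the stack
    ends empty. *)
Definition ctest ws a c p q :=
  cfold cpush (cfold cpush 0 (citer ws a p)) (crev (cinvcat 0 (citer ws c q))).

Lemma ctestP (b : n.-tuple (word n)) u v p q :
  ctest (code_words b) (code_word u) (code_word v) p q = 0 <->
  weq (iter p (subst (tnth b)) u) (iter q (subst (tnth b)) v).
Proof.
rewrite /ctest !citer_word; set U := iter p _ u; set V := iter q _ v.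
rewrite (cinvcat_word [::]) cats0 crev_word revK.
rewrite (@foldl_letters _ (@push n) [::]); last exact: cpush_code.
rewrite (@foldl_letters _ (@push n)); last exact: cpush_code.
rewrite -foldl_cat -/(reduce _) -weq_catV weq_nilP; case: (reduce _) => [|l s]; split=> //.
by rewrite code_word_cons; have := lt_ccons (letter_num l) (code_word s); case: (ccons _ _).
Qed.

(** The accumulator already has the format of [code_answer]: 0 until a pair passes the test, then
    the successor of its code. Any [k] decodes to some pair, and that pair is re-encoded. *)
Definition csearch ws a c K := nat_rect (fun=> nat) 0 (fun k r =>
  ifz r (ifz (ctest ws a c (chead k) (chead (ctail k)))
             (ccons (chead k) (ccons (chead (ctail k)) 0)).+1 0) r) K.

Lemma csearchP ws a c K :
  (exists p q, csearch ws a c K = (ccode [:: p; q]).+1 /\ ctest ws a c p q = 0) \/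
  (csearch ws a c K = 0 /\ forall k, k < K -> ctest ws a c (chead k) (chead (ctail k)) <> 0).
Proof.
elim: K => [|K [[p [q [e t]]]|[e no]]]; first by right.
  by left; exists p, q; split=> //=; rewrite -/(csearch _ _ _ K) e.
rewrite /= -/(csearch _ _ _ K) e /=; case e0: (ctest _ _ _ _ _) => [|m].
  by left; exists (chead K), (chead (ctail K)).
right; split=> // k; rewrite ltnS leq_eqVlt => /orP[/eqP ->|/no //].
by rewrite e0.
Qed.

End WordPrograms.

(** * Computability of the word programs *)

Lemma comp_cinv n (F : n.-tuple nat -> nat) : computable F -> computable (fun x => cinv (F x)).
Proof. by rewrite /cinv => hF; comp. Qed.

Lemma comp_cpush n (F G : n.-tuple nat -> nat) : computable F -> computable G ->
  computable (fun x => cpush (F x) (G x)).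
Proof. by rewrite /cpush /cinv => hF hG; comp. Qed.

Lemma comp_crev n (F : n.-tuple nat -> nat) : computable F -> computable (fun x => crev (F x)).
Proof.
by move=> hF; apply: (@comp_cfold _ (fun r l _ => ccons l r) (fun=> 0)) => //; comp.
Qed.

Lemma comp_ccatrev n (F G : n.-tuple nat -> nat) : computable F -> computable G ->
  computable (fun x => ccatrev (F x) (G x)).
Proof. by move=> hF hG; apply: (@comp_cfold _ (fun r l _ => ccons l r)) => //; comp. Qed.
#[local] Hint Resolve comp_cinv comp_cpush comp_crev comp_ccatrev : comp.

Lemma comp_cinvcat n (F G : n.-tuple nat -> nat) : computable F -> computable G ->
  computable (fun x => cinvcat (F x) (G x)).
Proof.
move=> hF hG.
by apply: (@comp_cfold _ (fun r l _ => ccons (cinv l) r) F (fun x => crev (G x))); comp.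
Qed.
#[local] Hint Resolve comp_cinvcat : comp.

Lemma comp_csubst n (F G : n.-tuple nat -> nat) : computable F -> computable G ->
  computable (fun x => csubst (F x) (G x)).
Proof.
move=> hF hG; have hF2 := computable_behead (computable_behead hF); apply: comp_crev.
apply: (@comp_cfold _ (fun r c x => ifz (odd c) (ccatrev r (cnth c./2 (F x)))
  (cinvcat r (cnth c./2 (F x)))) (fun=> 0)) => //; comp.
Qed.
#[local] Hint Resolve comp_csubst : comp.

Lemma comp_citer n (F G H : n.-tuple nat -> nat) : computable F -> computable G -> computable H ->
  computable (fun x => citer (F x) (G x) (H x)).
Proof.
move=> hF hG hH; have hF2 := computable_behead (computable_behead hF).
by apply: (@computable_rec _ _ _ (fun _ r x => csubst (F x) r)); comp.
Qed.
#[local] Hint Resolve comp_citer : comp.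

Lemma comp_ctest n (F G H P Q : n.-tuple nat -> nat) :
  computable F -> computable G -> computable H -> computable P -> computable Q ->
  computable (fun x => ctest (F x) (G x) (H x) (P x) (Q x)).
Proof.
move=> hF hG hH hP hQ.
apply: (@comp_cfold _ (fun r l _ => cpush r l)
  (fun x => cfold cpush 0 (citer (F x) (G x) (P x)))); [|by comp|by comp].
by apply: (@comp_cfold _ (fun r l _ => cpush r l) (fun=> 0)); comp.
Qed.
#[local] Hint Resolve comp_ctest : comp.

Lemma comp_csearch n (F G H K : n.-tuple nat -> nat) :
  computable F -> computable G -> computable H -> computable K ->
  computable (fun x => csearch (F x) (G x) (H x) (K x)).
Proof.
move=> hF hG hH hK; have h2 := fun hF => computable_behead (computable_behead hF).
have hF2 := h2 _ _ hF; have hG2 := h2 _ _ hG; have hH2 := h2 _ _ hH.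
by apply: (@computable_rec _ _ _ (fun k r x =>
  ifz r (ifz (ctest (F x) (G x) (H x) (chead k) (chead (ctail k)))
             (ccons (chead k) (ccons (chead (ctail k)) 0)).+1 0) r)); comp.
Qed.

(** * Computability of the bounds *)

Section BoundComputable.
Variable n : nat.
Implicit Types F G H : n.-tuple nat -> nat.

Lemma comp_kron_bound F : computable F -> computable (fun x => kron_bound (F x)).
Proof. by rewrite /kron_bound => hF; comp. Qed.

Lemma comp_spectral_bound F G H : computable F -> computable G -> computable H ->
  computable (fun x => spectral_bound (F x) (G x) (H x)).
Proof. by rewrite /spectral_bound => hF hG hH; comp. Qed.

#[local] Hint Resolve comp_kron_bound comp_spectral_bound : comp.

Lemma comp_growth_bound F G H : computable F -> computable G -> computable H ->
  computable (fun x => growth_bound (F x) (G x) (H x)).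
Proof. by rewrite /growth_bound => hF hG hH; comp. Qed.

#[local] Hint Resolve comp_growth_bound : comp.

Lemma comp_orbit_bound F G H : computable F -> computable G -> computable H ->
  computable (fun x => orbit_bound (F x) (G x) (H x)).
Proof. by rewrite /orbit_bound => hF hG hH; comp. Qed.

#[local] Hint Resolve comp_orbit_bound : comp.

Lemma comp_period_bound F : computable F -> computable (fun x => period_bound (F x)).
Proof. by rewrite /period_bound => hF; comp. Qed.

#[local] Hint Resolve comp_period_bound : comp.

Lemma comp_mon_count F G : computable F -> computable G ->
  computable (fun x => mon_count (F x) (G x)).
Proof.
move=> hF hG; have hF2 := computable_behead (computable_behead hF).
apply: (@computable_ext _ (fun x => nat_rect (fun=> nat) 1 (fun _ r => (F x * r).+1) (G x))).
  by move=> x; rewrite /mon_count; elim: (G x) => //= k ->.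
by apply: (@computable_rec _ _ _ (fun _ r x => (F x * r).+1)); comp.
Qed.

#[local] Hint Resolve comp_mon_count : comp.

Lemma comp_norm_bound F G H : computable F -> computable G -> computable H ->
  computable (fun x => norm_bound (F x) (G x) (H x)).
Proof. by rewrite /norm_bound /entry_bound => hF hG hH; comp. Qed.

Lemma comp_degree_bound F G : computable F -> computable G ->
  computable (fun x => degree_bound (F x) (G x)).
Proof. by rewrite /degree_bound => hF hG; comp. Qed.

#[local] Hint Resolve comp_norm_bound comp_degree_bound : comp.

Lemma comp_word_bound F G : computable F -> computable G ->
  computable (fun x => word_bound (F x) (G x)).
Proof. by rewrite /word_bound => hF hG; comp. Qed.

#[local] Hint Resolve comp_word_bound : comp.

Lemma comp_search_bound F G : computable F -> computable G ->
  computable (fun x => search_bound (F x) (G x)).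
Proof. by rewrite /search_bound /shift_bound => hF hG; comp. Qed.

End BoundComputable.

(** * Free bases *)

(* The group which the universal property of F maps to: it detects inequality of words. *)
Record magnus_op n := MagnusOp {
  op_fwd : (seq 'I_n -> int) -> (seq 'I_n -> int);
  op_bwd : (seq 'I_n -> int) -> (seq 'I_n -> int);
  op_fwdK : cancel op_fwd op_bwd;
  op_bwdK : cancel op_bwd op_fwd }.

HB.instance Definition _ n := gen_eqMixin (magnus_op n).
HB.instance Definition _ n := gen_choiceMixin (magnus_op n).

Section MagnusGroup.
Variable n : nat.
Implicit Types g h : magnus_op n.

Lemma magnus_op_eq g h : op_fwd g = op_fwd h -> g = h.
Proof.
case: g h => [f b fK bK] [f' b' fK' bK'] /= e; subst f'.
have e : b = b' by apply/funext => a; rewrite -{1}(bK' a) fK.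
by subst b'; congr MagnusOp; exact: Prop_irrelevance.
Qed.

Definition op_one : magnus_op n := @MagnusOp n id id (fun=> erefl) (fun=> erefl).
Definition op_inv g := MagnusOp (@op_bwdK n g) (@op_fwdK n g).
Definition op_mul g h := MagnusOp (can_comp (@op_fwdK n g) (@op_fwdK n h))
  (can_comp (@op_bwdK n h) (@op_bwdK n g)).

Lemma op_mulA : associative op_mul. Proof. by move=> f g h; exact: magnus_op_eq. Qed.
Lemma op_mul1 : left_id op_one op_mul. Proof. by move=> g; exact: magnus_op_eq. Qed.
Lemma op_mulr1 : right_id op_one op_mul. Proof. by move=> g; exact: magnus_op_eq. Qed.
Lemma op_mulV : left_inverse op_one op_inv op_mul.
Proof. by move=> g; apply/magnus_op_eq/funext => a; exact: op_fwdK. Qed.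
Lemma op_mulrV : right_inverse op_one op_inv op_mul.
Proof. by move=> g; apply/magnus_op_eq/funext => a; exact: op_bwdK. Qed.

End MagnusGroup.

HB.instance Definition _ n :=
  isGroup.Build (magnus_op n) (@op_mulA n) (@op_mul1 n) (@op_mulr1 n) (@op_mulV n) (@op_mulrV n).

Section FreeBasis.
Variables (n : nat) (F : groupType) (x : 'I_n -> F).
Implicit Types w : word n.
Local Open Scope group_scope.

Lemma eval_word_cat w w' : eval_word x (w ++ w') = eval_word x w * eval_word x w'.
Proof. exact: big_cat. Qed.

Lemma eval_word_cons l w : eval_word x (l :: w) = (if l.2 then (x l.1)^-1 else x l.1) * eval_word x w.
Proof. exact: big_cons. Qed.

Lemma eval_word_nil : eval_word x [::] = 1. Proof. exact: big_nil. Qed.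

Lemma eval_word_inv w : eval_word x (word_inv w) = (eval_word x w)^-1.
Proof.
elim: w => [|l w IH]; first by rewrite eval_word_nil invg1.
rewrite eval_word_cons -cat1s word_inv_cat eval_word_cat IH invgM; congr (_ * _).
by rewrite eval_word_cons eval_word_nil mulg1 /=; case: l => i []; rewrite //= invgK.
Qed.

Lemma weq_eval w w' : weq w w' -> eval_word x w = eval_word x w'.
Proof.
move=> /weq_catV e; apply/eqP; rewrite -divg_eq1 -eval_word_inv -eval_word_cat; apply/eqP.
move: (w ++ _) e; apply: weq_nil_ind => [|w1 l w2]; first exact: eval_word_nil.
rewrite !eval_word_cat !eval_word_cons => <-; congr (_ * _).
by case: l => i []; rewrite /= ?mulVKg ?mulKVg ?mulKg.
Qed.

(** Freeness sends [x i] to multiplication by 1 + X_i, so the evaluation of a word determines its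
    Magnus action. *)
Lemma eval_weq w w' : free_basis x -> eval_word x w = eval_word x w' -> weq w w'.
Proof.
move=> fx e.
pose op i := MagnusOp (@mul_genK n i) (@mul_gen_invK n i).
have [h [hx _]] := fx (magnus_op n : groupType) op.
have h1 : h 1 = 1 by apply: (mulgI (h 1)); rewrite -gmulfM !mulg1.
have hV a : h a^-1 = (h a)^-1.
  by apply: (mulgI (h a)); rewrite -gmulfM !mulgV.
have hE v : op_fwd (h (eval_word x v)) = magnus v.
  elim: v => [|l v IH]; first by rewrite eval_word_nil h1.
  rewrite eval_word_cons gmulfM; apply/funext => a.
  rewrite magnus_cons -IH; case: l => i [] /=; rewrite ?hV hx //.
by rewrite /weq -!hE e.
Qed.

Variables (phi : {multiplicative F -> F}) (b : n.-tuple (word n)).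
Hypothesis phi_b : forall i, phi (x i) = eval_word x (tnth b i).

Lemma eval_subst w : eval_word x (subst (tnth b) w) = phi (eval_word x w).
Proof.
have phi1 : phi 1 = 1 by apply: (mulgI (phi 1)); rewrite -gmulfM !mulg1.
have phiV a : phi a^-1 = (phi a)^-1.
  by apply: (mulgI (phi a)); rewrite -gmulfM !mulgV.
elim: w => [|l w IH]; first by rewrite /= eval_word_nil phi1.
rewrite subst_cons eval_word_cons eval_word_cat gmulfM IH; congr (_ * _).
by case: l.2; rewrite ?phiV phi_b ?eval_word_inv.
Qed.

Lemma eval_iter_subst k w : eval_word x (iter k (subst (tnth b)) w) = iter k phi (eval_word x w).
Proof. by elim: k => //= k IH; rewrite eval_subst IH. Qed.

End FreeBasis.

Theorem theorem1p3 :
  exists alg : murec 4,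
    forall (n : nat) (F : groupType) (x : 'I_n -> F)
           (phi : {multiplicative F -> F}) (w : n.-tuple (word n))
           (u v : word n),
      free_basis x ->
      (forall i : 'I_n, phi (x i) = eval_word x (tnth w i)) ->
      exists a : option (nat * nat),
        computes alg (code_input w u v) (code_answer a) /\
        match a with
        | Some (p, q) =>
            iter p phi (eval_word x u) = iter q phi (eval_word x v)
        | None =>
            ~ exists p q : nat,
                iter p phi (eval_word x u) = iter q phi (eval_word x v)
        end.
Proof.
pose B n L := search_bound n L.
(* Pair codes increase in both entries, so all pairs with entries at most [B n L] have codes below
   [K n L]. *)
pose K n L := (ccons (B n L) (ccons (B n L) 0)).+1.
pose i1 : 'I_4 := lift ord0 ord0.
pose i2 : 'I_4 := lift ord0 (lift ord0 ord0).
pose i3 : 'I_4 := lift ord0 (lift ord0 (lift ord0 ord0)).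
(* Codes dominate lengths, so the sum of the three input codes is an admissible [L] for the images
   and for both words. *)
pose len (z : 4.-tuple nat) := tnth z i1 + tnth z i2 + tnth z i3.
have [alg halg] : computable (fun z : 4.-tuple nat =>
    csearch (tnth z i1) (tnth z i2) (tnth z i3) (K (tnth z ord0) (len z))).
  have hlen : computable len by rewrite /len; comp.
  have hB := comp_search_bound (computable_tnth ord0) hlen.
  by apply: comp_csearch; rewrite /K /B; comp.
exists alg => n F x phi w u v fx phiw.
have := halg (code_input w u v).
rewrite [tnth _ ord0]/= [tnth _ i1]/= [tnth _ i2]/= [tnth _ i3]/=.
set L := len _; have eL : L = code_words w + code_word u + code_word v by [].
have [[p [q [e t]]]|[e no]] := csearchP (code_words w) (code_word u) (code_word v) (K n L).
  rewrite e => hc; exists (Some (p, q)); split=> //.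
  rewrite -!(eval_iter_subst phiw); apply: weq_eval; exact/ctestP.
rewrite e => hc; exists None; split=> // -[p [q]].
rewrite -!(eval_iter_subst phiw) => /(eval_weq fx) epq.
have size_code (s : word n) : size s <= code_word s.
  by rewrite -(size_map (@letter_num n)); exact: size_le_code.
have hw i : size (tnth w i) <= L.
  apply: leq_trans (size_code _) _; rewrite eL -addnA; apply: leq_trans (leq_addr _ _).
  by apply: mem_le_code; apply/map_f/mem_tnth.
have hu : size u <= L by apply: leq_trans (size_code _) _; rewrite eL; lia.
have hv : size v <= L by apply: leq_trans (size_code _) _; rewrite eL; lia.
have [p' [q' [hp hq epq']]] := orbit_search_bound hw hu hv epq.
apply: (no (ccode [:: p'; q'])).
  rewrite ltnS !code_cons /ccons; apply: leq_mul; first by rewrite leq_exp2l.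
  by rewrite ltnS leq_double; apply: leq_mul; rewrite // leq_exp2l.
by rewrite !code_cons ctail_cons !chead_cons; apply/ctestP.
Qed.
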